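(* Let $n\ge 1$ and let $f_1,\dots,f_n$ be $A_{n-1}$ theta functions of norm $t$. Then $$\det_{1\leq i,j\leq n}\left(f_j(x_i)\right)=C\,\theta(tx_1\cdots x_n)\,W_{A_{n-1}}(x)$$ for some constant $C$ (independent of $x_1,\dots,x_n\in\mathbb C\setminus\{0\}$). Moreover, if $R$ denotes either $B_n$, $B_n^\vee$, $C_n$, $C_n^\vee$, $BC_n$ or $D_n$ and $f_1,\dots,f_n$ are $R$ theta functions, then $$\det_{1\leq i,j\leq n}\left(f_j(x_i)\right)=C\,W_R(x)$$ for some constant $C$ (independent of $x_1,\dots,x_n\in\mathbb C\setminus\{0\}$).
   Context: Fix $p\in\mathbb C$ with $0<|p|<1$, and (for $C_n^\vee$) a fixed choice of square root $p^{1/2}$. Put $(a;q)_\infty=\prod_{j\ge0}(1-aq^j)$, $\theta(x;q)=(x;q)_\infty(q/x;q)_\infty$ for $x\ne0$, $\theta(x)=\theta(x;p)$, and $\theta(xy^{\pm})=\theta(xy)\theta(x/y)$. Let $t$ be a nonzero complex number and let $f$ be holomorphic on $\mathbb C\setminus\{0\}$. Call $f$ an $A_{n-1}$ theta function of norm $t$ if $f(px)=\frac{(-1)^n}{t x^n}f(x)$. Call $f$ an $R$ theta function if, for all $x\neq 0$: - $R=B_n$: $f(px)=-\frac{1}{p^{n-1}x^{2n-1}}f(x)$ and $f(1/x)=-\frac1x f(x)$; - $R=B_n^\vee$: $f(px)=-\frac{1}{p^{n}x^{2n}}f(x)$ and $f(1/x)=-f(x)$; - $R=C_n$: $f(px)=\frac{1}{p^{n+1}x^{2n+2}}f(x)$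 and $f(1/x)=-f(x)$; - $R=C_n^\vee$: $f(px)=\frac{1}{p^{n-1/2}x^{2n}}f(x)$ and $f(1/x)=-\frac1x f(x)$; - $R=BC_n$: $f(px)=\frac{1}{p^{n}x^{2n+1}}f(x)$ and $f(1/x)=-\frac1x f(x)$; - $R=D_n$: $f(px)=\frac{1}{p^{n-1}x^{2n-2}}f(x)$ and $f(1/x)=f(x)$. The Macdonald denominators are, for $x=(x_1,\dots,x_n)$: $$W_{A_{n-1}}(x)=\prod_{1\le i<j\le n}x_j\theta(x_i/x_j),\qquad W_{D_n}(x)=\prod_{1\le i<j\le n}x_i^{-1}\theta(x_ix_j^\pm),$$ $$W_{B_n}(x)=\prod_{i=1}^n\theta(x_i)\, W_{D_n}(x),\qquad W_{B_n^\vee}(x)=\prod_{i=1}^nx_i^{-1}\theta(x_i^2;p^2)\,W_{D_n}(x),$$ $$W_{C_n}(x)=\prod_{i=1}^nx_i^{-1}\theta(x_i^2)\,W_{D_n}(x),\qquad W_{C_n^\vee}(x)=\prod_{i=1}^n\theta(x_i;p^{1/2})\,W_{D_n}(x),$$ $$W_{BC_n}(x)=\prod_{i=1}^n\theta(x_i)\theta(px_i^2;p^2)\,W_{D_n}(x).$$ *)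

(* Defs.v *)
From mathcomp Require Import all_boot all_order all_algebra.
From mathcomp Require Import complex.
From mathcomp Require Import all_classical all_reals all_analysis.

Set Implicit Arguments.
Unset Strict Implicit.
Unset Printing Implicit Defensive.

Import Order.TTheory GRing.Theory Num.Theory.
Import numFieldNormedType.Exports.

Local Open Scope classical_set_scope.
Local Open Scope complex_scope.
Local Open Scope ring_scope.

(* The topology and the normed module structure over the scalar field R[i]
   live on the regular module R[i]^o, hence the casts below. *)

Section ThetaFunctions.
Variable R : realType.
Implicit Types (a q p s t x y : R[i]) (n : nat).

(* The increment in [derivable] ranges over the scalar field R[i], so this is
   complex differentiability at every point of the punctured plane; the value
   of f at 0 is irrelevant. *)
Definition holomorphic_punctured (f : R[i] -> R[i]) : Prop :=
  forall z : R[i], z != 0 -> derivable (f : R[i]^o -> R[i]^o) z 1.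

Definition qpochhammer a q : R[i] :=
  lim ((fun N : nat => \prod_(0 <= j < N) (1 - a * q ^+ j) : R[i]^o) @ \oo).

(* thetaq q x is theta(x; q) *)
Definition thetaq q x : R[i] := qpochhammer x q * qpochhammer (q / x) q.

(* thetaq_pm q x y is theta(x y^{+-}; q) *)
Definition thetaq_pm q x y : R[i] := thetaq q (x * y) * thetaq q (x / y).

Definition A_theta_function p n t (f : R[i] -> R[i]) : Prop :=
  holomorphic_punctured f /\
  forall x, x != 0 -> f (p * x) = (-1) ^+ n / (t * x ^+ n) * f x.

Inductive root_type : Set := Bn | Bnv | Cn | Cnv | BCn | Dn.

(* s is the chosen square root of p, so that s ^+ (2 * n - 1) is p^{n - 1/2}.
   The exponents involve truncated subtraction and are meant for n >= 1. *)
Definition R_quasi_period p s n (X : root_type) x : R[i] :=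
  match X with
  | Bn  => - (1 / (p ^+ (n - 1) * x ^+ (2 * n - 1)))
  | Bnv => - (1 / (p ^+ n * x ^+ (2 * n)))
  | Cn  => 1 / (p ^+ (n + 1) * x ^+ (2 * n + 2))
  | Cnv => 1 / (s ^+ (2 * n - 1) * x ^+ (2 * n))
  | BCn => 1 / (p ^+ n * x ^+ (2 * n + 1))
  | Dn  => 1 / (p ^+ (n - 1) * x ^+ (2 * n - 2))
  end.

Definition R_inversion (X : root_type) x : R[i] :=
  match X with
  | Bn | Cnv | BCn => - (1 / x)
  | Bnv | Cn => - 1
  | Dn => 1
  end.

Definition R_theta_function p s n (X : root_type) (f : R[i] -> R[i]) : Prop :=
  holomorphic_punctured f /\
  forall x, x != 0 ->
    f (p * x) = R_quasi_period p s n X x * f x /\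
    f (1 / x) = R_inversion X x * f x.

Definition W_A p n (x : 'I_n -> R[i]) : R[i] :=
  \prod_(i < n) \prod_(j < n | (i < j)%N) (x j * thetaq p (x i / x j)).

Definition W_D p n (x : 'I_n -> R[i]) : R[i] :=
  \prod_(i < n) \prod_(j < n | (i < j)%N)
    ((x i)^-1 * thetaq_pm p (x i) (x j)).

Definition W_R p s n (X : root_type) (x : 'I_n -> R[i]) : R[i] :=
  match X with
  | Bn  => \prod_(i < n) thetaq p (x i) * W_D p x
  | Bnv => \prod_(i < n) ((x i)^-1 * thetaq (p ^+ 2) (x i ^+ 2)) * W_D p x
  | Cn  => \prod_(i < n) ((x i)^-1 * thetaq p (x i ^+ 2)) * W_D p x
  | Cnv => \prod_(i < n) thetaq s (x i) * W_D p x
  | BCn => \prod_(i < n) (thetaq p (x i) * thetaq (p ^+ 2) (p * x i ^+ 2))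
             * W_D p x
  | Dn  => W_D p x
  end.

End ThetaFunctions.

(* Main.v *)
Require Import Defs.
From mathcomp Require Import all_boot all_order all_algebra fingroup perm.
From mathcomp Require Import complex ring lra zify.
From mathcomp Require Import all_classical all_reals all_analysis.

(** For each root type the theta functions form a linear space V of dimension at most n,
and the determinant is, in each of its n variables, an element of V; it is moreover
alternating. Alternating functions of n variables with all slots in a space of dimension
at most n form a line (det_proportional): such a function is determined by its value at
one well chosen point. So it suffices to know that the denominator W_R, respectively
theta(t x_1 ... x_n) W_A, lies in that line and is not identically zero. No division by
theta functions and no location of zeros of the f_j is involved.

The bound on the dimension comes from Fourier coefficients on the unit circle (A_separated,
R_separated). A quasi-period f(p x) = c x^-N f(x) reads p^k a_k = c a_(k+N), so that N
consecutive coefficients determine all the others, and the behaviour under x -> 1/x reflects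
the coefficients and cuts N down to n. This uses two facts about a function holomorphic
outside 0. First, the coefficients of f(y x) are y^k a_k for all complex y <> 0, because the
mean over a circle does not depend on its radius: this is Goursat's theorem, proved by
bisection for rectangles in the coordinate log x (goursat, mean_dilate). Secondly, f
vanishes if all its coefficients do (coef_eq0): writing f(x) = f(1) + (x - 1) phi(x), the
coefficients of phi are constant on each half-line of indices, hence 0 by Bessel's
inequality, so that f(1) = 0. As only continuous functions of a real variable are
integrated, integrals are defined as differences of values of a primitive.

That the denominators have all slots in V is a computation from theta(q x) = theta(1/x) =
- theta(x) / x (slotwise_A, slotwise_W_R), once theta is known to be holomorphic. The
latter follows from the expansion P(x + h) = P(x) + h D + h^2 S of the partial products of
the q-Pochhammer symbol: all three terms obey the same kind of recursion, whose solutions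
converge and are bounded (cderivable_qpochhammer). The denominators do not vanish at
suitable points of increasing moduli, since theta(x; q) <> 0 for |q| < |x| < 1
(W_R_neq0, A_denominator_neq0). *)

Set Implicit Arguments.
Unset Strict Implicit.
Unset Printing Implicit Defensive.

Import Order.TTheory GRing.Theory Num.Theory.
Import numFieldNormedType.Exports.

Local Open Scope complex_scope.
Local Open Scope ring_scope.

(** * The taxicab norm on the complex numbers *)

Section L1Norm.
Variable R : realType.
Implicit Types z w : R[i].

(** The modulus of a complex number is itself a complex number here. This norm takes
its values in the real field and is submultiplicative, which is all that the estimates
below need. *)
Definition L1 z : R := `|complex.Re z| + `|complex.Im z|.

Lemma L1_ge0 z : 0 <= L1 z.
Proof. by rewrite addr_ge0. Qed.

Lemma L1_0 : L1 0 = 0.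
Proof. by rewrite /L1 /= normr0 addr0. Qed.

Lemma L1_1 : L1 1 = 1.
Proof. by rewrite /L1 /= normr0 normr1 addr0. Qed.

Lemma L1_eq0 z : L1 z = 0 -> z = 0.
Proof.
move=> h; apply/eqP; rewrite eq_complex /=.
have h1 := normr_ge0 (complex.Re z); have h2 := normr_ge0 (complex.Im z).
rewrite -(normr_eq0 (complex.Re z)) -(normr_eq0 (complex.Im z)).
by rewrite !eq_le h1 h2 !andbT -h /L1 lerDl lerDr h1 h2.
Qed.

Lemma L1N z : L1 (- z) = L1 z.
Proof. by case: z => a b; rewrite /L1 /= !normrN. Qed.

Lemma L1D z w : L1 (z + w) <= L1 z + L1 w.
Proof.
case: z w => a b [c d]; rewrite /L1 /= addrACA.
by apply: lerD; apply: ler_normD.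
Qed.

Lemma L1B z w : L1 (z - w) = L1 (w - z).
Proof. by rewrite -L1N opprB. Qed.

Lemma L1_dist z w : L1 z <= L1 w + L1 (z - w).
Proof. by have := L1D w (z - w); rewrite addrC subrK. Qed.

Lemma L1M z w : L1 (z * w) <= L1 z * L1 w.
Proof.
case: z w => a b [c d]; rewrite /L1 /=.
have h1 : `|a * c - b * d| <= `|a| * `|c| + `|b| * `|d|.
  by rewrite -!normrM; apply: ler_normB.
have h2 : `|a * d + b * c| <= `|a| * `|d| + `|b| * `|c|.
  by rewrite -!normrM; apply: ler_normD.
apply: le_trans (lerD h1 h2) _; rewrite le_eqVlt; apply/orP; left.
by apply/eqP; ring.
Qed.

Lemma Re_le_L1 z : `|complex.Re z| <= L1 z.
Proof. by rewrite lerDl. Qed.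

Lemma Im_le_L1 z : `|complex.Im z| <= L1 z.
Proof. by rewrite lerDr. Qed.

Lemma norm_le_L1 z : `|z| <= (L1 z)%:C.
Proof.
rewrite {1}(complexE z) /L1 rmorphD /=; apply: le_trans (ler_normD _ _) _.
by rewrite normrM !normc_def /= !expr0n /= !addr0 expr1n add0r sqrtr1 mul1r !sqrtr_sqr.
Qed.

Lemma L1_le_norm z : (L1 z)%:C <= 2 * `|z|.
Proof.
have h1 := normc_ge_Re z.
have h2 : `|complex.Im z|%:C <= `|z|.
  have := normc_ge_Re (z * 'i); rewrite ReiNIm normrN => /le_trans; apply.
  by rewrite normrM (normc_def 'i%C) /= expr0n expr1n add0r sqrtr1 mulr1.
by rewrite /L1 rmorphD /= mulr2n mulrDl mul1r lerD.
Qed.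

End L1Norm.

(** * Primitives of continuous real functions *)

Section RealPrimitive.
Local Open Scope classical_set_scope.
Variable R : realType.
Implicit Types f F : R -> R.

Lemma primitive_right f (a : R) : continuous f ->
  exists F, forall x : R, a < x -> is_derive x (1 : R) F (f x).
Proof.
move=> cf.
exists (fun y : R => \int[lebesgue_measure]_(t in `[a, y]) f t)%R => x ax.
have int1 : lebesgue_measure.-integrable `[a, x + 1] (EFin \o f).
  apply: continuous_compact_integrable; first exact: segment_compact.
  by apply: continuous_subspaceT.
have [||d e] := @continuous_FTC1 R f (BLeft a) x (x + 1) _ int1 _ (cf x).
- by rewrite ltrDl.
- by rewrite /= lte_fin.
- by apply: DeriveDef; [exact: d|rewrite -derive1E; exact: e].
Qed.

Lemma is_derive_eq_itv (F G f : R -> R) (a b : R) :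
  (forall x : R, a < x < b -> is_derive x (1 : R) F (f x)) ->
  (forall x : R, a < x < b -> is_derive x (1 : R) G (f x)) ->
  forall x y, a < x < b -> a < y < b -> F x - F y = G x - G y.
Proof.
move=> dF dG.
have main x y : a < x < b -> a < y < b -> x < y -> F x - F y = G x - G y.
  move=> /andP[ax xb] /andP[ay yb] xy.
  have inab z : x <= z <= y -> a < z < b.
    move=> /andP[h1 h2].
    by rewrite (lt_le_trans ax h1) (le_lt_trans h2 yb).
  have dH z : x <= z <= y -> is_derive z (1 : R) (F - G) 0.
    move=> /inab h; have h1 := dF _ h; have h2 := dG _ h.
    by apply: is_derive_eq; rewrite subrr.
  have [||c _ ] := @MVT_segment R (F - G) (fun=> 0) x y (ltW xy).
  - by move=> z; rewrite in_itv /= => /andP[/ltW h1 /ltW h2]; apply: dH; rewrite h1.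
  - apply: continuous_in_subspaceT => z /set_mem /=; rewrite in_itv /= => zxy.
    apply: differentiable_continuous; apply/derivable1_diffP.
    by have := dH z zxy => h; apply: ex_derive.
  rewrite mul0r !fctE => /eqP; rewrite subr_eq0 => /eqP h.
  by rewrite -[F x](subrK (G x)) -h; ring.
move=> x y hx hy; have [xy|yx|->] := ltgtP x y; first exact: main.
- by apply/eqP; rewrite -eqr_opp !opprB; apply/eqP; apply: main.
- by rewrite !subrr.
Qed.

(** The integral only provides primitives on half-lines; the two half-line
primitives based at -1 and at 1 (the latter obtained by reflection) agree on
]-1, 1[ up to a constant, hence glue. *)
Lemma primitive_exists f : continuous f ->
  exists F, forall x : R, is_derive x (1 : R) F (f x).
Proof.
move=> cf; have [A dA] := primitive_right (-1) cf.
have cfo : continuous (fun x => f (- x)).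
  by move=> x; apply: (@continuous_comp _ _ _ -%R f); [exact: opp_continuous|exact: cf].
have [B0 dB0] := primitive_right (-1) cfo.
pose B x := - B0 (- x).
have dB (x : R) : x < 1 -> is_derive x (1 : R) B (f x).
  move=> x1; have h : is_derive (- x) (1 : R) B0 (f x).
    by have := dB0 (- x); rewrite opprK; apply; rewrite ltrN2.
  have h2 : is_derive x (1 : R) (B0 \o -%R) (f x * -1).
    by apply: is_derive1_comp.
  have -> : B = - (B0 \o -%R) by [].
  by apply: is_derive_eq; rewrite mulrN1 opprK.
pose F x := if 0 <= x then A x - A 0 else B x - B 0.
have FA x : -1 < x -> F x = A x - A 0.
  move=> x1; rewrite /F; case: ifPn => //; rewrite -ltNge => x0.
  apply: (@is_derive_eq_itv _ _ f (-1) 1) => //.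
  - by move=> y /andP[_]; exact: dB.
  - by move=> y /andP[+ _]; exact: dA.
  - by rewrite x1 (lt_trans x0) ?ltr01.
  - by rewrite ltr01 oppr_lt0 ltr01.
have FB x : x < 1 -> F x = B x - B 0.
  move=> x1; rewrite /F; case: ifPn => // x0.
  apply: (@is_derive_eq_itv _ _ f (-1) 1) => //.
  - by move=> y /andP[+ _]; exact: dA.
  - by move=> y /andP[_]; exact: dB.
  - by rewrite x1 (lt_le_trans _ x0) ?oppr_lt0 ?ltr01.
  - by rewrite ltr01 oppr_lt0 ltr01.
have aux (G H : R -> R) (c x d : R) : (\forall y \near x, H y = G y - c) ->
    is_derive x (1 : R) G d -> is_derive x (1 : R) H d.
  move=> hn dG; have h : is_derive x (1 : R) (G - cst c) d.
    by apply: is_derive_eq; rewrite subr0.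
  have hn' : {near x, (G - cst c) =1 H} by near=> y; rewrite (near hn y).
  apply: DeriveDef; first by apply: near_eq_derivable hn' _; exact: ex_derive.
  by rewrite -(near_eq_derive _ hn'); exact: derive_val.
exists F => x; have [x0|x0] := leP 0 x.
- apply: (aux A F (A 0)); last by apply: dA; rewrite (lt_le_trans _ x0) ?oppr_lt0 ?ltr01.
  near=> y; apply: FA; near: y; apply: lt_nbhsr.
  by rewrite (lt_le_trans _ x0) ?oppr_lt0 ?ltr01.
- apply: (aux B F (B 0)); last by apply: dB; rewrite (lt_trans x0) ?ltr01.
  near=> y; apply: FB; near: y; apply: lt_nbhsl.
  by rewrite (lt_trans x0) ?ltr01.
Unshelve. all: by end_near. Qed.

End RealPrimitive.

(** * Integrals of complex functions of a real variable *)

Section SegmentIntegral.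
Local Open Scope classical_set_scope.
Variable R : realType.
Implicit Types (f : R -> R) (g h F G : R -> R[i]) (a b c v x y : R).

Lemma ReD (z w : R[i]) : complex.Re (z + w) = complex.Re z + complex.Re w.
Proof. by case: z w => ? ? []. Qed.

Lemma ImD (z w : R[i]) : complex.Im (z + w) = complex.Im z + complex.Im w.
Proof. by case: z w => ? ? []. Qed.

Lemma ReN (z : R[i]) : complex.Re (- z) = - complex.Re z.
Proof. by case: z. Qed.

Lemma ImN (z : R[i]) : complex.Im (- z) = - complex.Im z.
Proof. by case: z. Qed.

Definition rcontinuous g :=
  continuous (fun v => complex.Re (g v)) /\ continuous (fun v => complex.Im (g v)).

Definition primitive F g := forall v,
  is_derive v (1 : R) (fun v => complex.Re (F v)) (complex.Re (g v)) /\
  is_derive v (1 : R) (fun v => complex.Im (F v)) (complex.Im (g v)).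

(** The integral of g along [a, b], read off from any primitive; the value is
meaningful as soon as g has one, in particular for continuous g. *)
Definition cint a b g : R[i] :=
  let F := xget (fun=> 0 : R[i]) [set F : R -> R[i] | primitive F g] in F b - F a.

Lemma is_derive_inj f1 f2 f :
  (forall x : R, is_derive x (1 : R) f1 (f x)) ->
  (forall x : R, is_derive x (1 : R) f2 (f x)) ->
  forall a b, f1 b - f1 a = f2 b - f2 a.
Proof.
move=> d1 d2 a b; have [l [u [hl hu]]] : exists l u : R, l < a < u /\ l < b < u.
  exists (Num.min a b - 1), (Num.max a b + 1).
  by rewrite !ltrBlDr !ltr_pwDr ?ltr01 ?ge_min ?le_max ?lexx ?orbT.
by apply: (@is_derive_eq_itv _ _ _ f l u).
Qed.

Lemma primitive_inj F G g a b :
  primitive F g -> primitive G g -> F b - F a = G b - G a.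
Proof.
move=> dF dG.
have h1 := is_derive_inj (fun x => (dF x).1) (fun x => (dG x).1) a b.
have h2 := is_derive_inj (fun x => (dF x).2) (fun x => (dG x).2) a b.
move: h1 h2; case: (F a) (F b) (G a) (G b) => [? ?] [? ?] [? ?] [? ?] /= h1 h2.
by apply/eqP; rewrite eq_complex /= h1 h2 !eqxx.
Qed.

Lemma cintE F g a b : primitive F g -> cint a b g = F b - F a.
Proof.
move=> dF; apply: (primitive_inj a b _ dF).
by apply: (@xgetPex _ (fun=> 0) [set F | primitive F g]); exists F.
Qed.

Lemma rcontinuous_primitive g : rcontinuous g -> exists F, primitive F g.
Proof.
move=> [/primitive_exists[A dA] /primitive_exists[B dB]].
by exists (fun v => A v +i* B v) => v; split => /=.
Qed.

Lemma primitiveD F G g h : primitive F g -> primitive G h ->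
  primitive (fun v => F v + G v) (fun v => g v + h v).
Proof.
move=> dF dG v; have [F1 F2] := dF v; have [G1 G2] := dG v.
have -> : (fun v => complex.Re (F v + G v)) =
    (fun v => complex.Re (F v)) + (fun v => complex.Re (G v)).
  by apply/funext => w; rewrite ReD.
have -> : (fun v => complex.Im (F v + G v)) =
    (fun v => complex.Im (F v)) + (fun v => complex.Im (G v)).
  by apply/funext => w; rewrite ImD.
by rewrite ReD ImD; split; exact: is_deriveD.
Qed.

Lemma primitiveZ (k : R[i]) F g : primitive F g ->
  primitive (fun v => k * F v) (fun v => k * g v).
Proof.
case: k => p q dF v; have [F1 F2] := dF v.
have -> : (fun v => complex.Re ((p +i* q) * F v)) =
    (p *: (fun v => complex.Re (F v))) - (q *: (fun v => complex.Im (F v))).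
  by apply/funext => w; rewrite !fctE; case: (F w).
have -> : (fun v => complex.Im ((p +i* q) * F v)) =
    (p *: (fun v => complex.Im (F v))) + (q *: (fun v => complex.Re (F v))).
  by apply/funext => w; rewrite !fctE; case: (F w).
have -> : complex.Re ((p +i* q) * g v) = p * complex.Re (g v) - q * complex.Im (g v).
  by case: (g v).
have -> : complex.Im ((p +i* q) * g v) = p * complex.Im (g v) + q * complex.Re (g v).
  by case: (g v).
by split; [apply: is_deriveB; exact: is_deriveZ|apply: is_deriveD; exact: is_deriveZ].
Qed.

Lemma primitive_shift c F g : primitive F g ->
  primitive (fun v => F (v + c)) (fun v => g (v + c)).
Proof.
move=> dF v; have [F1 F2] := dF (v + c).
have d : is_derive v (1 : R) (fun x : R => x + c) 1.
  have -> : (fun x : R => x + c) = id + cst c by [].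
  by apply: is_derive_eq; rewrite addr0.
by split; rewrite -[_ (g _)]mulr1; apply: (is_derive1_comp _ d).
Qed.

Lemma primitive_rev F g : primitive F g ->
  primitive (fun v => - F (- v)) (fun v => g (- v)).
Proof.
move=> dF v; have [F1 F2] := dF (- v).
have d : is_derive v (1 : R) (fun x : R => - x) (-1).
  by have -> : (fun x : R => - x) = - id by []; exact: is_derive_eq.
have aux f e : is_derive (- v) (1 : R) f e ->
    is_derive v (1 : R) (fun x : R => - f (- x)) e.
  move=> df; have h := is_derive1_comp df d.
  have -> : (fun x : R => - f (- x)) = - (f \o (fun x => - x)) by [].
  by apply: is_derive_eq; rewrite mulrN1 opprK.
have -> : (fun v => complex.Re (- F (- v))) = (fun v => - complex.Re (F (- v))).
  by apply/funext => w; rewrite ReN.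
have -> : (fun v => complex.Im (- F (- v))) = (fun v => - complex.Im (F (- v))).
  by apply/funext => w; rewrite ImN.
by split; [exact: (aux (fun v => complex.Re (F v)))|exact: (aux (fun v => complex.Im (F v)))].
Qed.

Lemma cint_ext a b g h : g =1 h -> cint a b g = cint a b h.
Proof. by move=> /funext ->. Qed.

Lemma cintD a b g h : rcontinuous g -> rcontinuous h ->
  cint a b (fun v => g v + h v) = cint a b g + cint a b h.
Proof.
move=> /rcontinuous_primitive[F dF] /rcontinuous_primitive[G dG].
by rewrite (cintE _ _ (primitiveD dF dG)) (cintE _ _ dF) (cintE _ _ dG) /=; ring.
Qed.

Lemma cintZ a b k g : rcontinuous g -> cint a b (fun v => k * g v) = k * cint a b g.
Proof.
move=> /rcontinuous_primitive[F dF].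
by rewrite (cintE _ _ (primitiveZ k dF)) (cintE _ _ dF) mulrBr.
Qed.

Lemma cint_cat b a c g : rcontinuous g -> cint a c g = cint a b g + cint b c g.
Proof. by move=> /rcontinuous_primitive[F dF]; rewrite !(cintE _ _ dF); ring. Qed.

Lemma cint_shift c a b g : rcontinuous g ->
  cint a b (fun v => g (v + c)) = cint (a + c) (b + c) g.
Proof.
by move=> /rcontinuous_primitive[F dF]; rewrite (cintE _ _ (primitive_shift c dF)) (cintE _ _ dF).
Qed.

Lemma cint_rev a b g : rcontinuous g ->
  cint a b (fun v => g (- v)) = cint (- b) (- a) g.
Proof.
move=> /rcontinuous_primitive[F dF].
by rewrite (cintE _ _ (primitive_rev dF)) (cintE _ _ dF); ring.
Qed.

Lemma rcontinuousD g h : rcontinuous g -> rcontinuous h ->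
  rcontinuous (fun v => g v + h v).
Proof.
move=> [g1 g2] [h1 h2]; split=> v.
- have -> : (fun v => complex.Re (g v + h v)) =
      (fun v => complex.Re (g v) + complex.Re (h v)).
    by apply/funext => w; rewrite ReD.
  by apply: continuousD; [exact: g1|exact: h1].
- have -> : (fun v => complex.Im (g v + h v)) =
      (fun v => complex.Im (g v) + complex.Im (h v)).
    by apply/funext => w; rewrite ImD.
  by apply: continuousD; [exact: g2|exact: h2].
Qed.

Lemma rcontinuousM g h : rcontinuous g -> rcontinuous h ->
  rcontinuous (fun v => g v * h v).
Proof.
move=> [g1 g2] [h1 h2]; split=> v.
- have -> : (fun v => complex.Re (g v * h v)) =
      (fun v => complex.Re (g v) * complex.Re (h v) - complex.Im (g v) * complex.Im (h v)).
    by apply/funext => w; case: (g w) (h w) => ? ? [].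
  by apply: (continuousB (continuousM (g1 v) (h1 v)) (continuousM (g2 v) (h2 v))).
- have -> : (fun v => complex.Im (g v * h v)) =
      (fun v => complex.Re (g v) * complex.Im (h v) + complex.Im (g v) * complex.Re (h v)).
    by apply/funext => w; case: (g w) (h w) => ? ? [].
  by apply: (continuousD (continuousM (g1 v) (h2 v)) (continuousM (g2 v) (h1 v))).
Qed.

Lemma rcontinuous_cst (k : R[i]) : rcontinuous (fun=> k).
Proof. by split=> v; exact: cst_continuous. Qed.

Lemma rcontinuous_conj g : rcontinuous g -> rcontinuous (fun v => conjc (g v)).
Proof.
move=> [g1 g2]; split=> v.
- have -> : (fun v => complex.Re (conjc (g v))) = (fun v => complex.Re (g v)).
    by apply/funext => w; case: (g w).
  exact: g1.
- have -> : (fun v => complex.Im (conjc (g v))) = (fun v => - complex.Im (g v)).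
    by apply/funext => w; case: (g w).
  by apply: continuousN; exact: g2.
Qed.

Lemma rcontinuousP g :
  (forall v (e : R), 0 < e ->
     exists2 d : R, 0 < d & forall w, `|w - v| < d -> L1 (g w - g v) < e) ->
  rcontinuous g.
Proof.
move=> H; split=> v; apply/cvgrPdist_lt => e e0; have [d d0 hd] := H v e e0.
all: near=> w.
all: have hw : `|w - v| < d by rewrite distrC; near: w; exact: cvgr_dist_lt.
all: apply: le_lt_trans (hd w hw); rewrite distrC -?ReN -?ImN -?ReD -?ImD.
- exact: Re_le_L1.
- exact: Im_le_L1.
Unshelve. all: by end_near. Qed.

Lemma real_primitive_bound f1 f a b (M : R) : a <= b ->
  (forall x : R, is_derive x (1 : R) f1 (f x)) ->
  (forall x, a <= x <= b -> `|f x| <= M) -> `|f1 b - f1 a| <= M * (b - a).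
Proof.
move=> ab d1 hM; have [|c cab ->] := @MVT_segment R f1 f a b ab.
  apply: continuous_subspaceT => x; apply: differentiable_continuous.
  by apply/derivable1_diffP; have h := d1 x; exact: ex_derive.
rewrite normrM (ger0_norm (_ : 0 <= b - a)) ?subr_ge0 // ler_wpM2r ?subr_ge0 //.
by apply: hM; move: cab; rewrite in_itv.
Qed.

(** The factor 2 is lost by applying the mean value theorem to the real and imaginary
parts separately. *)
Lemma cint_bound a b g (M : R) : a <= b -> rcontinuous g ->
  (forall v, a <= v <= b -> L1 (g v) <= M) -> L1 (cint a b g) <= 2 * M * (b - a).
Proof.
move=> ab /rcontinuous_primitive[F dF] hM; rewrite (cintE _ _ dF).
rewrite -mulrA mulrDl mul1r /L1 ReD ReN ImD ImN; apply: lerD.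
- apply: (real_primitive_bound ab (fun x => (dF x).1)) => x xab.
  exact: le_trans (Re_le_L1 _) (hM x xab).
- apply: (real_primitive_bound ab (fun x => (dF x).2)) => x xab.
  exact: le_trans (Im_le_L1 _) (hM x xab).
Qed.

Lemma Re_cint_ge0 a b g : a <= b -> rcontinuous g ->
  (forall v, 0 <= complex.Re (g v)) -> 0 <= complex.Re (cint a b g).
Proof.
move=> ab /rcontinuous_primitive[F dF] h0; rewrite (cintE _ _ dF) ReD ReN.
have d1 x : is_derive x (1 : R) _ _ := (dF x).1.
have [|c cab ->] := @MVT_segment R _ _ a b ab (fun x _ => d1 x).
  apply: continuous_subspaceT => x; apply: differentiable_continuous.
  by apply/derivable1_diffP; have h := d1 x; exact: ex_derive.
by rewrite mulr_ge0 // subr_ge0.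
Qed.

Lemma is_derive_poly2 (k l m v : R) :
  is_derive v (1 : R) (fun v : R => k + l * v + m * v ^+ 2) (l + m * (2 * v)).
Proof.
have d2 : is_derive v (1 : R) (fun v : R => v ^+ 2) (2 * v).
  have -> : (fun v : R => v ^+ 2) = (id : R -> R) * (id : R -> R).
    by apply/funext => w; rewrite expr2.
  have := is_deriveM (is_derive_id v (1 : R)) (is_derive_id v (1 : R)).
  suff -> : (v : R^o) *: (1 : R^o) + (v : R^o) *: (1 : R^o) = 2 * v by [].
  by rewrite -[v *: 1]/(v * 1) mulr1 mulr_natl mulr2n.
have d1 : is_derive v (1 : R) (fun v : R => k + l * v) l.
  have -> : (fun v : R => k + l * v) = cst k + l *: (id : R -> R) by [].
  have := is_deriveD (is_derive_cst k v (1 : R)) (is_deriveZ l (is_derive_id v (1 : R))).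
  suff -> : (0 : R^o) + l *: (1 : R^o) = l by [].
  by rewrite add0r -[l *: _]/(l * 1) mulr1.
exact: (is_deriveD d1 (is_deriveZ m d2)).
Qed.

Lemma primitive_poly2 (k l m : R[i]) :
  primitive (fun v => k + l * v%:C + m * (v ^+ 2)%:C)
            (fun v => l + m * (2 * v)%:C).
Proof.
move=> v; case: k l m => k k' [l l'] [m m'].
have -> : (fun v => complex.Re (k +i* k' + (l +i* l') * v%:C + (m +i* m') * (v ^+ 2)%:C)) =
   (fun v => k + l * v + m * v ^+ 2).
  by apply/funext => w /=; rewrite !mulr0 !subr0.
have -> : (fun v => complex.Im (k +i* k' + (l +i* l') * v%:C + (m +i* m') * (v ^+ 2)%:C)) =
   (fun v => k' + l' * v + m' * v ^+ 2).
  by apply/funext => w /=; rewrite !mulr0 !add0r.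
have -> : complex.Re (l +i* l' + (m +i* m') * (2 * v)%:C) = l + m * (2 * v).
  by rewrite /= mulr0 subr0.
have -> : complex.Im (l +i* l' + (m +i* m') * (2 * v)%:C) = l' + m' * (2 * v).
  by rewrite /= mulr0 add0r.
by split; exact: is_derive_poly2.
Qed.

End SegmentIntegral.

(** * Goursat's theorem on rectangles *)

Section Goursat.
Variable R : realType.
Implicit Types (G H : R -> R -> R[i]) (u v a b : R).

(** Complex differentiability of u, v |-> G u v, read as a function of u + i v. *)
Definition cdiff2 G := forall u0 v0, exists D : R[i], forall e : R, 0 < e ->
  exists2 d : R, 0 < d & forall u v, `|u - u0| < d -> `|v - v0| < d ->
    L1 (G u v - (G u0 v0 + D * ((u - u0) +i* (v - v0)))) <= e * (`|u - u0| + `|v - v0|).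

Definition scontinuous G :=
  (forall v, rcontinuous (G^~ v)) /\ (forall u, rcontinuous (G u)).

(** The contour integral along the boundary of the rectangle [u1, u2] x [v1, v2]. *)
Definition box G u1 u2 v1 v2 : R[i] :=
  cint u1 u2 (G^~ v1) - cint u1 u2 (G^~ v2) + 'i%C * (cint v1 v2 (G u2) - cint v1 v2 (G u1)).

Lemma cdiff2_scontinuous G : cdiff2 G -> scontinuous G.
Proof.
move=> dG.
have key u0 v0 (e : R) : 0 < e -> exists2 d : R, 0 < d & forall u v, 
    `|u - u0| < d -> `|v - v0| < d -> `|u - u0| + `|v - v0| < d ->
    L1 (G u v - G u0 v0) < e.
  move=> e0; have [D hD] := dG u0 v0; have [d d0 hd] := hD 1 ltr01.
  have K0 : 0 < L1 D + 1 by rewrite ltr_wpDl ?L1_ge0 // ltr01.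
  (* the increment is at most (L1 D + 1) times the size of the displacement *)
  exists (Num.min d (e / (L1 D + 1))); first by rewrite lt_min d0 divr_gt0.
  move=> u v; rewrite !lt_min => /andP[hu _] /andP[hv _] /andP[_ huv].
  have := hd u v hu hv; rewrite mul1r => h.
  have -> : G u v - G u0 v0 = (G u v - (G u0 v0 + D * ((u - u0) +i* (v - v0))))
      + D * ((u - u0) +i* (v - v0)) by ring.
  apply: le_lt_trans (L1D _ _) _; apply: le_lt_trans (lerD h (L1M _ _)) _.
  rewrite [L1 (_ +i* _)]/L1 /=; move: huv; rewrite ltr_pdivlMr //.
  by rewrite mulrDr mulr1 addrC mulrC.
split=> [v|u]; apply: rcontinuousP => w e e0.
- have [d d0 hd] := key w v e e0; exists d => // w' hw.
  by apply: hd; rewrite ?subrr ?normr0 ?addr0.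
- have [d d0 hd] := key u w e e0; exists d => // w' hw.
  by apply: hd; rewrite ?subrr ?normr0 ?add0r.
Qed.

Lemma box_cat_u G u1 u2 u3 v1 v2 : scontinuous G ->
  box G u1 u3 v1 v2 = box G u1 u2 v1 v2 + box G u2 u3 v1 v2.
Proof.
by move=> [h1 h2]; rewrite /box (cint_cat u2 u1 u3 (h1 v1)) (cint_cat u2 u1 u3 (h1 v2)); ring.
Qed.

Lemma box_cat_v G u1 u2 v1 v2 v3 : scontinuous G ->
  box G u1 u2 v1 v3 = box G u1 u2 v1 v2 + box G u1 u2 v2 v3.
Proof.
by move=> [h1 h2]; rewrite /box (cint_cat v2 v1 v3 (h2 u1)) (cint_cat v2 v1 v3 (h2 u2)); ring.
Qed.

Lemma boxB G H u1 u2 v1 v2 : scontinuous G -> scontinuous H ->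
  box (fun u v => G u v - H u v) u1 u2 v1 v2 = box G u1 u2 v1 v2 - box H u1 u2 v1 v2.
Proof.
move=> [g1 g2] [h1 h2].
have aux a b (f g : R -> R[i]) : rcontinuous f -> rcontinuous g ->
    cint a b (fun v => f v - g v) = cint a b f - cint a b g.
  move=> cf cg; rewrite -[- cint a b g]mulN1r -cintZ // -cintD //.
    by apply: cint_ext => v; rewrite mulN1r.
  by apply: rcontinuousM => //; apply: rcontinuous_cst.
by rewrite /box !aux //; ring.
Qed.

Lemma box_bound G u1 u2 v1 v2 (M : R) : scontinuous G -> u1 <= u2 -> v1 <= v2 ->
  (forall u v, u1 <= u <= u2 -> v1 <= v <= v2 -> L1 (G u v) <= M) ->
  L1 (box G u1 u2 v1 v2) <= 4 * M * ((u2 - u1) + (v2 - v1)).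
Proof.
move=> [c1 c2] hu hv hM.
have b1 : L1 (cint u1 u2 (G^~ v1)) <= 2 * M * (u2 - u1).
  by apply: cint_bound => // u huu; apply: hM => //; rewrite lexx.
have b2 : L1 (cint u1 u2 (G^~ v2)) <= 2 * M * (u2 - u1).
  by apply: cint_bound => // u huu; apply: hM => //; rewrite hv lexx.
have b3 : L1 (cint v1 v2 (G u1)) <= 2 * M * (v2 - v1).
  by apply: cint_bound => // v hvv; apply: hM => //; rewrite lexx.
have b4 : L1 (cint v1 v2 (G u2)) <= 2 * M * (v2 - v1).
  by apply: cint_bound => // v hvv; apply: hM => //; rewrite hu lexx.
have Li : L1 ('i%C : R[i]) = 1 by rewrite /L1 /= normr0 normr1 add0r.
apply: le_trans (L1D _ _) _.
apply: le_trans (lerD (L1D _ _) (L1M _ _)) _; rewrite Li mul1r L1N.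
apply: le_trans (lerD (lexx _) (L1D _ _)) _; rewrite L1N.
by move: b1 b2 b3 b4; lra.
Qed.

Lemma box_affine (k D : R[i]) u1 u2 v1 v2 :
  box (fun u v => k + D * (u +i* v)) u1 u2 v1 v2 = 0.
Proof.
have split_i u v : (u +i* v : R[i]) = u%:C + 'i%C * v%:C.
  by rewrite (complexE (u +i* v)).
have h2 (x : R) : (2 * x)%:C = 2 * x%:C :> R[i] by rewrite rmorphM /= rmorph_nat.
have I1 v : cint u1 u2 (fun u => k + D * (u +i* v)) =
    (k + D * 'i%C * v%:C) * (u2%:C - u1%:C) + D / 2 * (u2%:C ^+ 2 - u1%:C ^+ 2).
  rewrite (cint_ext _ _ (_ : _ =1 (fun u => (k + D * 'i%C * v%:C) + D / 2 * (2 * u)%:C))).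
    by rewrite (cintE _ _ (primitive_poly2 0 _ _)) !rmorphXn /=; ring.
  by move=> u; rewrite split_i h2 /=; field.
have I2 u : cint v1 v2 (fun v => k + D * (u +i* v)) =
    (k + D * u%:C) * (v2%:C - v1%:C) + D * 'i%C / 2 * (v2%:C ^+ 2 - v1%:C ^+ 2).
  rewrite (cint_ext _ _ (_ : _ =1 (fun v => (k + D * u%:C) + D * 'i%C / 2 * (2 * v)%:C))).
    by rewrite (cintE _ _ (primitive_poly2 0 _ _)) !rmorphXn /=; ring.
  by move=> v; rewrite split_i h2 /=; field.
rewrite /box !I1 !I2; ring.
Qed.

Lemma nested_point (x : nat -> R) (a : R) :
  (forall n, x n <= x n.+1) ->
  (forall n, x n.+1 + a / 2 ^+ n.+1 <= x n + a / 2 ^+ n) -> 0 <= a ->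
  exists y, forall n, x n <= y <= x n + a / 2 ^+ n.
Proof.
move=> h1 h2 a0.
have nd (y : nat -> R) m n : (forall k, y k <= y k.+1) -> (m <= n)%N -> y m <= y n.
  move=> h /subnK <-; elim: (n - m)%N => [|k IH]; first by rewrite add0n.
  by rewrite addSn; exact: le_trans IH (h _).
have mono m n : (m <= n)%N -> x m <= x n by exact: nd.
have anti m n : (m <= n)%N -> x n + a / 2 ^+ n <= x m + a / 2 ^+ m.
  move=> mn; rewrite -lerN2; apply: (nd (fun n => - (x n + a / 2 ^+ n))) mn.
  by move=> k; rewrite lerN2.
have ub m n : x m <= x n + a / 2 ^+ n.
  apply: le_trans (mono _ _ (leq_maxl m n)) _.
  apply: le_trans (anti _ _ (leq_maxr m n)); by rewrite lerDl divr_ge0.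
pose S := [set x n | n in [set: nat]]%classic.
exists (sup S) => n; apply/andP; split.
- apply: ub_le_sup; last by exists n.
  by exists (x 0 + a / 2 ^+ 0) => _ [m _ <-].
- by apply: ge_sup; [exists (x 0); exists 0|move=> _ [m _ <-]].
Qed.

(** Goursat's argument: a rectangle whose boundary integral is K is quartered
repeatedly, keeping each time a quarter carrying at least a quarter of the
integral.  At the point common to all quarters the function is affine up to an
error of order o(size), and the boundary integral of an affine function vanishes,
so that K is smaller than any multiple of the area. *)
Lemma goursat G u1 u2 v1 v2 : cdiff2 G -> u1 < u2 -> v1 < v2 ->
  box G u1 u2 v1 v2 = 0.
Proof.
move=> dG u12 v12; have cG := cdiff2_scontinuous dG.
pose a := u2 - u1; pose b := v2 - v1.
have a0 : 0 < a by rewrite subr_gt0.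
have b0 : 0 < b by rewrite subr_gt0.
pose B al be (q : R * R) := L1 (box G q.1 (q.1 + al) q.2 (q.2 + be)).
pose stepu al be (q : R * R) : R * R :=
  if B al be q <= 2 * B (al / 2) be q then q else (q.1 + al / 2, q.2).
pose stepv al be (q : R * R) : R * R :=
  if B al be q <= 2 * B al (be / 2) q then q else (q.1, q.2 + be / 2).
have half x y : x + y / 2 + y / 2 = x + y :> R by field.
have hstepu al be q : B al be q <= 2 * B (al / 2) be (stepu al be q).
  rewrite /stepu; case: ifPn => //; rewrite -ltNge => hlt.
  have : B al be q <= B (al / 2) be q + B (al / 2) be (q.1 + al / 2, q.2).
    rewrite /B /= half (box_cat_u _ (q.1 + al / 2)) //; exact: L1D.
  by move: hlt; set X := B al be q; set Y := B _ _ q; set Z := B _ _ _; lra.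
have hstepv al be q : B al be q <= 2 * B al (be / 2) (stepv al be q).
  rewrite /stepv; case: ifPn => //; rewrite -ltNge => hlt.
  have : B al be q <= B al (be / 2) q + B al (be / 2) (q.1, q.2 + be / 2).
    rewrite /B /= half (box_cat_v _ _ _ (q.2 + be / 2)) //; exact: L1D.
  by move: hlt; set X := B al be q; set Y := B _ _ q; set Z := B _ _ _; lra.
pose st := fix st n : R * R := if n is m.+1 then
    stepv (a / 2 ^+ m / 2) (b / 2 ^+ m) (stepu (a / 2 ^+ m) (b / 2 ^+ m) (st m))
  else (u1, v1).
have div2 (c : R) n : c / 2 ^+ n / 2 = c / 2 ^+ n.+1.
  by rewrite exprS invfM mulrA mulrAC.
have stB n : B a b (u1, v1) <= 4 ^+ n * B (a / 2 ^+ n) (b / 2 ^+ n) (st n).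
  elim: n => [|n IH]; first by rewrite expr0 mul1r !divr1.
  apply: le_trans IH _; rewrite [4 ^+ n.+1]exprSr -mulrA ler_wpM2l ?exprn_ge0 //.
  apply: le_trans (hstepu _ _ _) _; have -> : 4 = 2 * 2 :> R by ring.
  rewrite -[2 * 2 * _]mulrA ler_wpM2l //; apply: le_trans (hstepv _ _ _) _.
  by rewrite /= !div2.
have pos (c : R) n : 0 < c -> 0 <= c / 2 ^+ n by move=> c0; rewrite divr_ge0 ?exprn_ge0 // ltW.
have su n : ((st n).1 <= (st n.+1).1) /\
    ((st n.+1).1 + a / 2 ^+ n.+1 <= (st n).1 + a / 2 ^+ n).
  have -> : (st n.+1).1 = (stepu (a / 2 ^+ n) (b / 2 ^+ n) (st n)).1.
    by rewrite /= /stepv; case: ifP.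
  have := pos a n.+1 a0; rewrite -div2.
  by rewrite /stepu; case: ifP => _ /=; set t := a / 2 ^+ n; lra.
have sv n : ((st n).2 <= (st n.+1).2) /\
    ((st n.+1).2 + b / 2 ^+ n.+1 <= (st n).2 + b / 2 ^+ n).
  have e : (stepu (a / 2 ^+ n) (b / 2 ^+ n) (st n)).2 = (st n).2.
    by rewrite /stepu; case: ifP.
  have := pos b n.+1 b0; rewrite -div2 /= /stepv.
  by case: ifP => _ /=; rewrite e; set t := b / 2 ^+ n; lra.
have [u0 hu0] := nested_point (fun n => (su n).1) (fun n => (su n).2) (ltW a0).
have [v0 hv0] := nested_point (fun n => (sv n).1) (fun n => (sv n).2) (ltW b0).
have [D hD] := dG u0 v0.
have small e : 0 < e -> B a b (u1, v1) <= e * (4 * (a + b) ^+ 2).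
  move=> e0; have [d d0 hd] := hD e e0.
  have [n hn] : exists n : nat, a / 2 ^+ n < d /\ b / 2 ^+ n < d.
    pose m := Num.max a b / d.
    have [n hn] : exists n : nat, m < 2 ^+ n.
      exists (Num.truncn m).+1; apply: lt_le_trans (truncnS_gt m) _.
      by rewrite -natrX ler_nat ltnW // ltn_expl.
    exists n; move: hn; rewrite /m ltr_pdivrMr // => hn.
    rewrite !ltr_pdivrMr ?exprn_gt0 // ![d * _]mulrC.
    by split; apply: le_lt_trans hn; rewrite le_max lexx ?orbT.
  case: hn => had hbd; apply: le_trans (stB n) _.
  have := hu0 n; have := hv0 n; move: had hbd.
  have := pos a n a0; have := pos b n b0.
  case: (st n) => u v; rewrite /B /=.
  set al := a / 2 ^+ n; set be := b / 2 ^+ n => be0 al0 ald bed hv hu.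
  (* Af is the affine part of G at the limit point, written as in box_affine *)
  pose Af u' v' := (G u0 v0 - D * (u0 +i* v0)) + D * (u' +i* v').
  have AfE u' v' : Af u' v' = G u0 v0 + D * ((u' - u0) +i* (v' - v0)).
    rewrite /Af; have -> : (u' - u0) +i* (v' - v0) = (u' +i* v') - (u0 +i* v0) by [].
    ring.
  have cAf : scontinuous Af.
    apply: cdiff2_scontinuous => u' v'; exists D => e' e'0; exists 1; first exact: ltr01.
    move=> x y _ _.
    have -> : (x - u') +i* (y - v') = (x +i* y) - (u' +i* v') by [].
    rewrite /Af (_ : _ - _ = 0); last by ring.
    by rewrite L1_0 mulr_ge0 ?addr_ge0 // ltW.
  have cGA : scontinuous (fun u' v' => G u' v' - Af u' v').
    have sN (g h : R -> R[i]) : rcontinuous g -> rcontinuous h -> rcontinuous (fun w => g w - h w).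
      move=> cg ch; apply: rcontinuousD => //.
      have -> : (fun w => - h w) = (fun w => -1 * h w) by apply/funext => w; rewrite mulN1r.
      by apply: rcontinuousM => //; exact: rcontinuous_cst.
    by split=> w; apply: sN; rewrite ?(cG.1 w) ?(cG.2 w) ?(cAf.1 w) ?(cAf.2 w) //;
       [exact: cG.1|exact: cAf.1|exact: cG.2|exact: cAf.2].
  have -> : box G u (u + al) v (v + be) = box (fun u' v' => G u' v' - Af u' v') u (u + al) v (v + be).
    by rewrite boxB // box_affine subr0.
  have bd : L1 (box (fun u' v' => G u' v' - Af u' v') u (u + al) v (v + be)) <=
      4 * (e * (al + be)) * (u + al - u + (v + be - v)).
    apply: box_bound; rewrite ?lerDl // => u' v' hu' hv'.
    have du : `|u' - u0| <= al by rewrite ler_norml; move: hu hu'; lra.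
    have dv : `|v' - v0| <= be by rewrite ler_norml; move: hv hv'; lra.
    rewrite AfE; apply: le_trans (hd _ _ _ _) _; try exact: le_lt_trans du _; try exact: le_lt_trans dv _.
    by rewrite ler_pM2l // lerD.
  have e4 : (4 : R) ^+ n = 2 ^+ n * 2 ^+ n.
    by rewrite -exprMn; congr (_ ^+ _); ring.
  have -> : e * (4 * (a + b) ^+ 2) = 4 ^+ n * (4 * (e * (al + be)) * (u + al - u + (v + be - v))).
    rewrite e4 /al /be; field; by rewrite expf_neq0 // pnatr_eq0.
  by rewrite ler_wpM2l ?exprn_ge0.
have : B a b (u1, v1) <= 0.
  rewrite leNgt; apply/negP => K0.
  have ab0 : 0 < 8 * (a + b) ^+ 2 by rewrite mulr_gt0 ?ltr0n // exprn_gt0 // addr_gt0.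
  have := small (B a b (u1, v1) / (8 * (a + b) ^+ 2)) (divr_gt0 K0 ab0).
  rewrite (_ : _ / _ * _ = B a b (u1, v1) / 2); last first.
    by field; rewrite gt_eqF // addr_gt0.
  by move: K0; set X := B _ _ _; lra.
rewrite /B /= /a /b !subrKC => h; apply: L1_eq0; apply/eqP.
by rewrite eq_le h L1_ge0.
Qed.

(** For a function periodic in v, the horizontal sides of a full period box cancel. *)
Lemma period_integral_indep G (T : R) : cdiff2 G -> 0 < T ->
  (forall u v, G u (v + T) = G u v) ->
  forall u1 u2, cint 0 T (G u1) = cint 0 T (G u2).
Proof.
move=> dG T0 per.
have main u1 u2 : u1 < u2 -> cint 0 T (G u1) = cint 0 T (G u2).
  move=> u12; have := goursat dG u12 T0.
  rewrite /box (cint_ext u1 u2 (_ : G^~ T =1 G^~ 0)); last first.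
    by move=> u; rewrite -(per u 0) add0r.
  rewrite subrr add0r => /eqP; rewrite mulf_eq0 => /orP[|].
    by rewrite eq_complex /= oner_eq0 andbF.
  by rewrite subr_eq0 => /eqP.
move=> u1 u2; have [h|h|->//] := ltgtP u1 u2; first exact: main.
by rewrite (main _ _ h).
Qed.

End Goursat.

(** * Complex differentiability *)

Section ComplexDerivative.
Variable R : realType.
Local Notation C := R[i].
Implicit Types (f g phi : C -> C) (z w : C).

Definition ccontinuous (phi : C -> C) z := {for z, continuous (phi : C^o -> C^o)}.

Lemma ccontinuousM f g z : ccontinuous f z -> ccontinuous g z ->
  ccontinuous (fun w => f w * g w) z.
Proof. by move=> cf cg; exact: (@continuousM C C^o f g z cf cg). Qed.

Lemma ccontinuousD f g z : ccontinuous f z -> ccontinuous g z ->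
  ccontinuous (fun w => f w + g w) z.
Proof. by move=> cf cg; exact: (@continuousD C C^o C^o f g z cf cg). Qed.

Lemma ccontinuousB f g z : ccontinuous f z -> ccontinuous g z ->
  ccontinuous (fun w => f w - g w) z.
Proof. by move=> cf cg; exact: (@continuousB C C^o C^o f g z cf cg). Qed.

Lemma ccontinuousV f z : f z != 0 -> ccontinuous f z -> ccontinuous (fun w => (f w)^-1) z.
Proof. by move=> fz cf; exact: (@continuousV C C^o f z fz cf). Qed.

Lemma ccontinuous_comp f g z : ccontinuous g z -> ccontinuous f (g z) ->
  ccontinuous (fun w => f (g w)) z.
Proof. by move=> cg cf; exact: (@continuous_comp C^o C^o C^o g f z cg cf). Qed.

Lemma ccontinuous_cst (c : C) z : ccontinuous (fun=> c) z.
Proof. exact: cst_continuous. Qed.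

Lemma ccontinuous_id z : ccontinuous id z.
Proof. exact: cvg_id. Qed.

Lemma continuousL1 phi z : ccontinuous phi z <->
  forall e : R, 0 < e -> exists2 d : R, 0 < d &
    forall w, L1 (w - z) < d -> L1 (phi w - phi z) < e.
Proof.
split=> [/cvgrPdist_lt h e e0|h].
- have e2 : 0 < (e / 2)%:C by rewrite ltcR divr_gt0.
  have /nbhs_ballP[d /= d0 hd] := h _ e2.
  have dE : d = (complex.Re d)%:C by rewrite RRe_real // gtr0_real.
  exists (complex.Re d); first by rewrite -ltcR -dE.
  move=> w hw; have /hd /= : ball (z : C^o) d w.
    rewrite -ball_normE /= dE; apply: le_lt_trans (norm_le_L1 _) _.
    by rewrite ltcR L1B.
  rewrite distrC => hlt; rewrite -ltcR; apply: le_lt_trans (L1_le_norm _) _.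
  by move: hlt; rewrite rmorphM /= fmorphV rmorph_nat ltr_pdivlMr // mulrC.
- apply: (@cvgrPdist_lt C C^o C^o (nbhs (z : C^o)) (nbhs_filter _) phi (phi z)).2 => e e0.
  have eE : e = (complex.Re e)%:C by rewrite RRe_real // gtr0_real.
  have [|d d0 hd] := h (complex.Re e); first by rewrite -ltcR -eE.
  apply/nbhs_ballP; exists (d / 2)%:C; first by rewrite /= ltcR divr_gt0.
  move=> w; rewrite -ball_normE /= => hw; rewrite distrC.
  apply: le_lt_trans (norm_le_L1 _) _; rewrite eE ltcR; apply: hd.
  rewrite -ltcR L1B; apply: le_lt_trans (L1_le_norm _) _.
  by move: hw; rewrite rmorphM /= fmorphV rmorph_nat ltr_pdivlMr // mulrC.
Qed.

(** Caratheodory's form of complex differentiability at z: the slope function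
extends continuously through z.  Besides making the calculus rules immediate, the
slope is the function to which the uniqueness theorem below applies Bessel. *)
Definition cderivable f z := exists2 phi : C -> C,
  ccontinuous phi z & forall w, f w = f z + (w - z) * phi w.

Lemma cderivable_continuous f z : cderivable f z -> ccontinuous f z.
Proof.
move=> [phi cphi /funext ->]; exact: (ccontinuousD (@ccontinuous_cst (f z) z)
  (ccontinuousM (ccontinuousB (@ccontinuous_id z) (@ccontinuous_cst z z)) cphi)).
Qed.

Lemma derivable_cderivable f z : derivable (f : C^o -> C^o) z 1 -> cderivable f z.
Proof.
move=> /cvg_ex[D hD].
exists (fun w => if w == z then D else (f w - f z) / (w - z)); last first.
  move=> w; case: eqP => [->|/eqP wz]; first by rewrite subrr mul0r addr0.
  by rewrite mulrCA divff ?subr_eq0 // mulr1 subrKC.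
set psi := (X in ccontinuous X z).
apply: (@cvgrPdist_lt C C^o C^o (nbhs (z : C^o)) (nbhs_filter _) psi (psi z)).2 => e e0.
rewrite /psi eqxx.
move/cvgrPdist_lt: hD => /(_ e e0) [d /= d0 hd].
apply/nbhs_ballP; exists d => // w; rewrite -ball_normE /= => hw.
case: ifPn => [_|wz]; first by rewrite subrr normr0.
have := hd (w - z); rewrite /= sub0r normrN distrC; move/(_ hw).
rewrite subr_eq0 => /(_ wz); rewrite -[(w - z) *: 1]/((w - z) * 1) mulr1 subrK.
by rewrite -[_ *: _]/(_ * _) [_^-1 * _]mulrC.
Qed.

Lemma cderivable_derivable f z : cderivable f z -> derivable (f : C^o -> C^o) z 1.
Proof.
move=> [phi cphi fE]; apply/cvg_ex; exists (phi z : C^o).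
apply/cvgrPdist_lt => e e0; move/cvgrPdist_lt: cphi => /(_ e e0) /nbhs_ballP[d /= d0 hd].
exists d => // h /=; rewrite sub0r normrN => hh h0.
have -> : h^-1 *: (f (h *: 1 + z) - f z : C^o) = phi (h + z).
  rewrite -[_ *: (f _ - _)]/(_ * _) -[h *: 1]/(h * 1) mulr1 fE addrK.
  by rewrite addrAC subrr add0r mulKf.
apply: hd.
by rewrite -ball_normE /= opprD addrCA subrr addr0 normrN.
Qed.

Lemma cderivable_cst (c : C) z : cderivable (fun=> c) z.
Proof. by exists (fun=> 0); [exact: cst_continuous|move=> w; rewrite mulr0 addr0]. Qed.

Lemma cderivable_id z : cderivable id z.
Proof. by exists (fun=> 1); [exact: cst_continuous|move=> w; rewrite mulr1 subrKC]. Qed.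

Lemma cderivableM f g z : cderivable f z -> cderivable g z ->
  cderivable (fun w => f w * g w) z.
Proof.
move=> df dg; have cg := cderivable_continuous dg.
move: df dg => [phi cphi fE] [psi cpsi gE].
exists (fun w => phi w * g w + f z * psi w).
  exact: (ccontinuousD (ccontinuousM cphi cg) (ccontinuousM (@ccontinuous_cst (f z) z) cpsi)).
by move=> w; rewrite {1}fE mulrDl {1}gE; ring.
Qed.

Lemma cderivable_comp f g z : cderivable g z -> cderivable f (g z) ->
  cderivable (fun w => f (g w)) z.
Proof.
move=> dg; have cg := cderivable_continuous dg.
move: dg => [psi cpsi gE] [phi cphi fE].
exists (fun w => psi w * phi (g w)).
  exact: (ccontinuousM cpsi (ccontinuous_comp cg cphi)).
by move=> w; rewrite fE -[g w - g z](_ : (w - z) * psi w = _) ?mulrA // gE; ring.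
Qed.

Lemma cderivableV z : z != 0 -> cderivable GRing.inv z.
Proof.
move=> z0; apply: derivable_cderivable.
have /= := @derivableV C^o C^o id z 1 z0; apply; exact: derivable_id.
Qed.

Lemma cderivableX f n z : cderivable f z -> cderivable (fun w => f w ^+ n) z.
Proof.
move=> df; elim: n => [|n IH]; first exact: cderivable_cst.
have -> : (fun w => f w ^+ n.+1) = (fun w => f w * f w ^+ n).
  by apply/funext => w; rewrite exprS.
exact: cderivableM.
Qed.

Lemma cderivable_prod (I : Type) (r : seq I) (P : pred I) (F : I -> C -> C) z :
  (forall i, P i -> cderivable (F i) z) ->
  cderivable (fun w => \prod_(i <- r | P i) F i w) z.
Proof.
move=> dF; elim: r => [|i r IH].
  have -> : (fun w => \prod_(i <- [::] | P i) F i w) = (fun=> 1).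
    by apply/funext => w; rewrite big_nil.
  exact: cderivable_cst.
have -> : (fun w => \prod_(j <- i :: r | P j) F j w) =
    (fun w => (if P i then F i w else 1) * \prod_(j <- r | P j) F j w).
  by apply/funext => w; rewrite big_cons; case: ifP => // _; rewrite mul1r.
apply: (cderivableM (f := fun w => if P i then F i w else 1)) IH.
by have [/dF //|_] := boolP (P i); exact: cderivable_cst.
Qed.

Lemma cderivable_exprz (k : int) z : z != 0 -> cderivable (fun w => w ^ k) z.
Proof.
move=> z0; case: k => n; first by apply: cderivableX; exact: cderivable_id.
have -> : (fun w : C => w ^ Negz n) = (fun w => w^-1 ^+ n.+1).
  by apply/funext => w; rewrite NegzE -exprnN exprVn.
by apply: cderivableX; exact: cderivableV.
Qed.

(** Away from the base point the slope is a quotient of continuous functions. *)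
Lemma slope_continuous f z z' (phi : C -> C) :
  ccontinuous f z' -> z' != z ->
  (forall w, f w = f z + (w - z) * phi w) -> ccontinuous phi z'.
Proof.
move=> cf z'z fE.
pose psi w := (f w - f z) / (w - z).
have cpsi : ccontinuous psi z'.
  have z0 : z' - z != 0 by rewrite subr_eq0.
  exact: (ccontinuousM (ccontinuousB cf (@ccontinuous_cst (f z) z'))
    (ccontinuousV (f := fun w => w - z) z0
      (ccontinuousB (@ccontinuous_id z') (@ccontinuous_cst z z')))).
have E w : w != z -> phi w = psi w.
  by move=> wz; rewrite /psi fE addrAC subrr add0r mulrAC divff ?mul1r // subr_eq0.
apply/continuousL1 => e e0; have /continuousL1/(_ e e0)[d d0 hd] := cpsi.
have zz0 : 0 < L1 (z - z').
  rewrite lt_neqAle L1_ge0 andbT eq_sym; apply/eqP => /L1_eq0/eqP.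
  by rewrite subr_eq0 eq_sym (negbTE z'z).
exists (Num.min d (L1 (z - z'))); first by rewrite lt_min d0.
move=> w; rewrite lt_min => /andP[h1 h2]; rewrite !E //; first exact: hd.
by apply/eqP => wz; move: h2; rewrite wz ltxx.
Qed.

End ComplexDerivative.

(** * Polar coordinates *)

Section PolarExponential.
Local Open Scope classical_set_scope.
Variable R : realType.
Local Notation C := R[i].
Implicit Types (u v : R).

(** The exponential of u + i v, in polar form. *)
Definition cexp u v : C := (expR u * cos v) +i* (expR u * sin v).

Lemma cexpD u u' v v' : cexp (u + u') (v + v') = cexp u v * cexp u' v'.
Proof.
rewrite /cexp expRD cosD sinD; apply/eqP; rewrite eq_complex /=.
by apply/andP; split; apply/eqP; ring.
Qed.

Lemma cexp00 : cexp 0 0 = 1.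
Proof. by rewrite /cexp expR0 cos0 sin0 mulr1 mulr0. Qed.

Lemma cexp_period u v : cexp u (v + 2 * pi) = cexp u v.
Proof. by rewrite /cexp mulr_natl cosD2pi sinD2pi. Qed.

Lemma cexpN u v : cexp (- u) (- v) * cexp u v = 1.
Proof. by rewrite -cexpD !addNr cexp00. Qed.

Lemma cexp_neq0 u v : cexp u v != 0.
Proof.
apply/eqP => h; have := cexpN u v; rewrite h mulr0 => /eqP.
by rewrite eq_sym oner_eq0.
Qed.

Lemma cexpV u v : (cexp u v)^-1 = cexp (- u) (- v).
Proof. by rewrite -[LHS]mul1r -(cexpN u v) mulfK ?cexp_neq0. Qed.

Lemma conj_cexp v : conjc (cexp 0 v) = (cexp 0 v)^-1.
Proof. by rewrite cexpV oppr0 /cexp /= cosN sinN mulrN. Qed.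

Lemma cexp_surj (z : C) : z != 0 -> exists u v, z = cexp u v.
Proof.
case: z => a b z0; pose r := Num.sqrt (a ^+ 2 + b ^+ 2).
have s0 : 0 < a ^+ 2 + b ^+ 2.
  rewrite lt_neqAle addr_ge0 ?sqr_ge0 // andbT eq_sym paddr_eq0 ?sqr_ge0 //.
  by rewrite !sqrf_eq0 -(eq_complex (a +i* b) 0).
have r0 : 0 < r by rewrite sqrtr_gt0.
have rr : r ^+ 2 = a ^+ 2 + b ^+ 2 by rewrite sqr_sqrtr // ltW.
have hu : expR (ln r) = r by rewrite lnK // posrE.
have cs : (a / r) ^+ 2 + (b / r) ^+ 2 = 1.
  by rewrite !expr_div_n -mulrDl -rr divff // expf_neq0 // gt_eqF.
have ar : -1 <= a / r <= 1.
  rewrite -ler_norml -(@expr_le1 _ 2) // -normrX ger0_norm ?sqr_ge0 //.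
  by rewrite -cs lerDl sqr_ge0.
have sq : Num.sqrt (1 - (a / r) ^+ 2) = `|b / r|.
  by rewrite -cs addrAC subrr add0r sqrtr_sqr.
exists (ln r), (if 0 <= b then acos (a / r) else - acos (a / r)).
rewrite /cexp hu; case: ifPn => [b0|]; last rewrite -ltNge => b0.
- rewrite acosK ?in_itv //= sin_acos // sq ger0_norm ?divr_ge0 ?(ltW r0) //.
  by rewrite ![r * _]mulrC !divfK ?gt_eqF.
- rewrite cosN sinN acosK ?in_itv //= sin_acos // sq ltr0_norm; last first.
    by rewrite ltr_pdivrMr // mul0r.
  by rewrite opprK ![r * _]mulrC !divfK ?gt_eqF.
Qed.

Lemma is_derive_o (f : R -> R) (a : R) : is_derive (0 : R) (1 : R) f a ->
  forall e : R, 0 < e -> exists2 d : R, 0 < d &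
    forall h, `|h| < d -> `|f h - f 0 - a * h| <= e * `|h|.
Proof.
move=> df e e0.
have hD : h^-1 *: (f (h *: 1 + 0) - f 0) @[h --> (0 : R)^'] --> a.
  have h1 : derivable f 0 (1 : R) by exact: ex_derive.
  by rewrite -(@derive_val _ _ _ _ _ _ _ df); exact: h1.
move/cvgrPdist_lt: hD => /(_ e e0) [d /= d0 hd]; exists d => // h hh.
have [->|h0] := eqVneq h 0; first by rewrite subrr mulr0 subrr normr0 mulr0.
have := hd h; rewrite /= sub0r normrN => /(_ hh h0).
rewrite addr0 -[h *: 1]/(h * 1) mulr1 -[_ *: _]/(_ * _) => hlt.
have -> : f h - f 0 - a * h = - (a - h^-1 * (f h - f 0)) * h.
  by rewrite mulNr mulrBl mulrAC mulVf // mul1r opprB.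
by rewrite normrM normrN ler_pM2r ?normr_gt0 // ltW.
Qed.

Lemma cexp_small (e : R) : 0 < e -> exists2 d : R, 0 < d &
  forall u v, `|u| < d -> `|v| < d ->
    L1 (cexp u v - 1 - (u +i* v)) <= e * (`|u| + `|v|).
Proof.
move=> e0; have [k [k0 k1 k5]] : exists k : R, [/\ 0 < k, k <= 1 & 5 * k <= e].
  (* with errors of relative size k on exp, cos and sin, the total is at most 5 k *)
  exists (Num.min 1 (e / 5)).
  rewrite lt_min ltr01 divr_gt0 // ge_min lexx; split=> //.
  by rewrite mulrC -ler_pdivlMr // ge_min lexx orbT.
have dE : is_derive (0 : R) (1 : R) expR 1 
  by have := is_derive_expR (0 : R); rewrite expR0.
have dC : is_derive (0 : R) (1 : R) cos 0 
  by have := is_derive_cos (0 : R); rewrite sin0 oppr0.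
have dS : is_derive (0 : R) (1 : R) sin 1 
  by have := is_derive_sin (0 : R); rewrite cos0.
have [d1 d10 h1] := is_derive_o dE k0.
have [d2 d20 h2] := is_derive_o dC k0.
have [d3 d30 h3] := is_derive_o dS k0.
exists (Num.min (Num.min d1 k) (Num.min d2 d3)); first by rewrite !lt_min d10 k0 d20 d30.
move=> u v; rewrite !lt_min => /andP[/andP[u1 uk] /andP[u2 u3]].
move=> /andP[/andP[v1 vk] /andP[v2 v3]].
have := h1 u u1; have := h2 v v2; have := h3 v v3.
rewrite expR0 cos0 sin0 subr0 mul0r subr0 !mul1r => hs hc he.
rewrite /L1 /cexp /=.
set E := expR u in he *; set S := sin v in hs *; set c := cos v in hc *.
have E0 : 0 <= E by exact: expR_ge0.
have E1 : `|E - 1| <= 2 * `|u|.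
  have -> : E - 1 = (E - 1 - u) + u by ring.
  apply: le_trans (ler_normD _ _) _; apply: le_trans (lerD he (lexx _)) _.
  by rewrite -{2}[`|u|]mul1r -mulrDl ler_wpM2r // lerD2r.
have S1 : `|S| <= 2 * k.
  have -> : S = (S - v) + v by ring.
  apply: le_trans (ler_normD _ _) _; apply: le_trans (lerD hs (ltW vk)) _.
  rewrite mulr2n mulrDl !mul1r lerD2r; apply: le_trans (_ : k * 1 <= _); last by rewrite mulr1.
  by rewrite ler_pM2l //; apply: ltW; exact: lt_le_trans vk k1.
have E3 : E <= 3.
  have := ler_norm (E - 1); have := le_trans (ltW uk) k1; move: E1; lra.
have a1 : `|E * c - 1 - u| <= k * `|u| + 3 * (k * `|v|).
  have -> : E * c - 1 - u = (E - 1 - u) + E * (c - 1) by ring.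
  apply: le_trans (ler_normD _ _) _; rewrite lerD // normrM (ger0_norm E0).
  by apply: ler_pM.
have a2 : `|E * S - 0 - v| <= k * `|v| + 2 * `|u| * (2 * k).
  have -> : E * S - 0 - v = (S - v) + (E - 1) * S by ring.
  by apply: le_trans (ler_normD _ _) _; rewrite lerD // normrM ler_pM.
apply: le_trans (lerD a1 a2) _.
apply: le_trans (_ : 5 * k * (`|u| + `|v|) <= _); last by rewrite ler_wpM2r ?addr_ge0.
have := mulr_ge0 (ltW k0) (normr_ge0 v); have := mulr_ge0 (ltW k0) (normr_ge0 u).
rewrite (_ : 2 * `|u| * (2 * k) = 4 * (k * `|u|)); last by ring.
rewrite (_ : 5 * k * _ = 5 * (k * `|u|) + 5 * (k * `|v|)); last by ring.
lra.
Qed.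

(** The chain rule for f at z = exp(u0 + i v0): the derivative is phi(z) z, where phi is
the slope of f at z. *)
Lemma cderivable_cexp (f : C -> C) :
  (forall z, z != 0 -> cderivable f z) -> cdiff2 (fun u v => f (cexp u v)).
Proof.
move=> df u0 v0; set z := cexp u0 v0.
have [phi cphi fE] := df z (cexp_neq0 _ _).
exists (phi z * z) => e e0.
pose K := L1 (phi z) * L1 z + 1; pose M := L1 z * 2 + 1.
have K0 : 0 < K by rewrite ltr_wpDl // mulr_ge0 ?L1_ge0.
have M0 : 0 < M by rewrite ltr_wpDl // mulr_ge0 ?L1_ge0.
have e1 : 0 < Num.min 1 (e / 2 / K) by rewrite lt_min ltr01 !divr_gt0.
have [d1 d10 h1] := cexp_small e1.
have e2 : 0 < e / 2 / M by rewrite !divr_gt0.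
have /continuousL1/(_ _ e2)[d2 d20 h2] := cphi.
pose d3 := d2 / M / 2.
have d30 : 0 < d3 by rewrite !divr_gt0.
exists (Num.min d1 d3); first by rewrite lt_min d10.
move=> u v; rewrite !lt_min => /andP[u1 u3] /andP[v1 v3].
set h := (u - u0) +i* (v - v0); set N := `|u - u0| + `|v - v0|.
have hN : L1 h = N by [].
pose r := cexp (u - u0) (v - v0) - 1 - h.
have hr : L1 r <= Num.min 1 (e / 2 / K) * N by exact: h1.
have N0 : 0 <= N by rewrite addr_ge0.
have zE : cexp u v - z = z * h + z * r.
  by rewrite -{1}[u](subrKC u0) -{1}[v](subrKC v0) cexpD /r -/z; ring.
have r1 : L1 r <= N.
  by apply: le_trans hr _; rewrite ler_piMl // ge_min lexx.
have hz : L1 (cexp u v - z) <= M * N.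
  rewrite zE -mulrDr; apply: le_trans (L1M _ _) _.
  apply: le_trans (_ : L1 z * (N + N) <= _).
    by rewrite ler_wpM2l ?L1_ge0 //; apply: le_trans (L1D _ _) _; rewrite lerD // hN.
  by rewrite -mulr2n -mulr_natl mulrA ler_wpM2r // lerDl.
have hphi : L1 (phi (cexp u v) - phi z) < e / 2 / M.
  apply: h2; apply: le_lt_trans hz _.
  rewrite mulrC -ltr_pdivlMr //; have := u3; have := v3.
  by rewrite /N /d3; lra.
have -> : f (cexp u v) - (f z + phi z * z * h) =
    (cexp u v - z) * (phi (cexp u v) - phi z) + phi z * z * r.
  rewrite fE (_ : (cexp u v - z) * (phi (cexp u v) - phi z) =
    (cexp u v - z) * phi (cexp u v) - (z * h + z * r) * phi z); last by rewrite -zE; ring.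
  by ring.
apply: le_trans (L1D _ _) _.
have b1 : L1 ((cexp u v - z) * (phi (cexp u v) - phi z)) <= e / 2 * N.
  apply: le_trans (L1M _ _) _.
  apply: le_trans (ler_pM (L1_ge0 _) (L1_ge0 _) hz (ltW hphi)) _.
  by rewrite mulrC mulrA divfK // gt_eqF.
have b2 : L1 (phi z * z * r) <= e / 2 * N.
  apply: le_trans (L1M _ _) _.
  apply: le_trans (_ : K * (e / 2 / K * N) <= _); last first.
    by rewrite mulrA [K * _]mulrC divfK // gt_eqF.
  apply: ler_pM; rewrite ?L1_ge0 //.
    by apply: le_trans (L1M _ _) _; rewrite lerDl.
  by apply: le_trans hr _; rewrite ler_wpM2r // ge_min lexx orbT.
by move: b1 b2; lra.
Qed.

End PolarExponential.

(** * Fourier coefficients on the unit circle *)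

Section FourierCoefficients.
Variable R : realType.
Local Notation C := R[i].
Implicit Types (f g h phi : C -> C) (x y z : C) (k m : int).

Definition holomorphic f := forall z, z != 0 -> cderivable f z.

Lemma holomorphicM f g : holomorphic f -> holomorphic g ->
  holomorphic (fun x => f x * g x).
Proof. by move=> df dg z z0; apply: cderivableM; [exact: df|exact: dg]. Qed.

Lemma holomorphic_cst (c : C) : holomorphic (fun=> c).
Proof. by move=> z _; exact: cderivable_cst. Qed.

Lemma holomorphic_exprz k : holomorphic (fun x => x ^ k).
Proof. by move=> z z0; exact: cderivable_exprz. Qed.

Lemma holomorphic_comp f g : holomorphic f -> holomorphic g ->
  (forall z, z != 0 -> g z != 0) -> holomorphic (fun x => f (g x)).
Proof.
by move=> df dg g0 z z0; apply: cderivable_comp; [exact: dg|apply: df; exact: g0].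
Qed.

Definition circle_continuous h := rcontinuous (fun v => h (cexp 0 v)).

Lemma holomorphic_circle f : holomorphic f -> circle_continuous f.
Proof. by move=> /cderivable_cexp/cdiff2_scontinuous[_]; apply. Qed.

Lemma continuous_circle h : (forall z, z != 0 -> ccontinuous h z) -> circle_continuous h.
Proof.
move=> ch; apply: rcontinuousP => v e e0.
have [_ cE] := cdiff2_scontinuous (cderivable_cexp (fun z _ => cderivable_id z)).
have /continuousL1/(_ e e0)[d d0 hd] := ch _ (cexp_neq0 0 v).
have d2 : 0 < d / 2 by rewrite divr_gt0.
have [/(_ v)/cvgrPdist_lt/(_ _ d2) n1 /(_ v)/cvgrPdist_lt/(_ _ d2) n2] := cE 0.
have : \forall w \near v, L1 (cexp 0 w - cexp 0 v) < d.
  near=> w; rewrite L1B /L1 ReD ReN ImD ImN [d]splitr.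
  by rewrite ltrD //; near: w.
by move=> /nbhs_ballP[r /= r0 hr]; exists r => // w hw; apply/hd/hr; rewrite /ball /= distrC.
Unshelve. all: by end_near. Qed.

Lemma circle_continuousM f g : circle_continuous f -> circle_continuous g ->
  circle_continuous (fun x => f x * g x).
Proof. exact: rcontinuousM. Qed.

Lemma circle_continuousD f g : circle_continuous f -> circle_continuous g ->
  circle_continuous (fun x => f x + g x).
Proof. exact: rcontinuousD. Qed.

Lemma circle_continuous_conj f : circle_continuous f ->
  circle_continuous (fun x => conjc (f x)).
Proof. exact: rcontinuous_conj. Qed.

Lemma circle_continuous_cst (c : C) : circle_continuous (fun=> c).
Proof. exact: rcontinuous_cst. Qed.

Lemma circle_continuous_exprz k : circle_continuous (fun x => x ^ k).
Proof. exact/holomorphic_circle/holomorphic_exprz. Qed.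

Definition period : R := 2 * pi.

Lemma period_gt0 : 0 < period.
Proof. by rewrite mulr_gt0 ?pi_gt0. Qed.

(** Integral over the unit circle for the angular measure, of total mass 2 pi. *)
Definition mean h : C := cint 0 period (fun v => h (cexp 0 v)).

Lemma meanD f g : circle_continuous f -> circle_continuous g ->
  mean (fun x => f x + g x) = mean f + mean g.
Proof. exact: cintD. Qed.

Lemma meanZ (c : C) f : circle_continuous f -> mean (fun x => c * f x) = c * mean f.
Proof. exact: cintZ. Qed.

Lemma mean_cst (c : C) : mean (fun=> c) = c * period%:C.
Proof.
rewrite /mean (cint_ext _ _ (_ : _ =1 (fun v : R => c + 0 * (2 * v)%:C))).
  by rewrite (cintE _ _ (primitive_poly2 0 c 0)) /=; ring.
by move=> v; rewrite mul0r addr0.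
Qed.

Lemma eq_mean f g : (forall x, x != 0 -> f x = g x) -> mean f = mean g.
Proof. by move=> fg; apply: cint_ext => v; apply: fg; exact: cexp_neq0. Qed.

Lemma mean_conj f : circle_continuous f -> mean (fun x => conjc (f x)) = conjc (mean f).
Proof.
move=> /rcontinuous_primitive[F dF]; rewrite /mean (cintE _ _ dF).
have dF' : primitive (fun v => conjc (F v)) (fun v => conjc (f (cexp 0 v))).
  move=> v; have [d1 d2] := dF v; split.
    have -> : (fun v => complex.Re (conjc (F v))) = (fun v => complex.Re (F v)).
      by apply/funext => w; case: (F w).
    by have -> : complex.Re (conjc (f (cexp 0 v))) = complex.Re (f (cexp 0 v)) by case: (f _).
  have -> : (fun v => complex.Im (conjc (F v))) = - (fun v => complex.Im (F v)).
    by apply/funext => w; rewrite !fctE; case: (F w).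
  have -> : complex.Im (conjc (f (cexp 0 v))) = - complex.Im (f (cexp 0 v)) by case: (f _).
  exact: is_deriveN.
by rewrite (cintE _ _ dF') rmorphB.
Qed.

Lemma cint_period (g : R -> C) (a b : R) : rcontinuous g ->
  (forall v, g (v + period) = g v) -> cint a (a + period) g = cint b (b + period) g.
Proof.
move=> cg per; rewrite (cint_cat b) // (cint_cat (b + period) b (a + period)) //.
rewrite -(cint_shift period b a cg) (cint_ext b a per).
rewrite addrC -addrA -cint_cat //.
have /rcontinuous_primitive[F dF] := cg.
by rewrite (cintE b b dF) subrr addr0.
Qed.

(** A change of argument is absorbed by periodicity, a change of radius by Goursat's
theorem in the coordinates u + i v = log x. *)
Lemma mean_circle_shift f u v0 : holomorphic f ->
  cint 0 period (fun v => f (cexp u (v + v0))) = mean f.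
Proof.
move=> df; have dG := cderivable_cexp df; have [_ cG] := cdiff2_scontinuous dG.
have per u' v : f (cexp u' (v + period)) = f (cexp u' v) by rewrite cexp_period.
rewrite (cint_shift v0 0 period (cG u)) add0r [period + _]addrC.
rewrite (cint_period v0 0 (cG u) (per u)) add0r.
exact: (period_integral_indep dG period_gt0 per).
Qed.

Lemma mean_dilate f y : holomorphic f -> y != 0 -> mean (fun x => f (y * x)) = mean f.
Proof.
move=> df /cexp_surj[u [v0 ->]]; rewrite -[RHS](mean_circle_shift u v0 df).
by apply: cint_ext => v; rewrite -cexpD addr0 addrC.
Qed.

Lemma mean_inv f : holomorphic f -> mean (fun x => f x^-1) = mean f.
Proof.
move=> df; have cf := holomorphic_circle df.
rewrite /mean (cint_ext _ _ (_ : _ =1 (fun v => f (cexp 0 (- v))))); last first.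
  by move=> v; rewrite cexpV oppr0.
rewrite (cint_rev 0 period cf) oppr0.
have per v : f (cexp 0 (v + period)) = f (cexp 0 v) by rewrite cexp_period.
by have := cint_period (- period) 0 cf per; rewrite addNr add0r.
Qed.

Definition coef f k : C := mean (fun x => f x * x ^ (- k)).

Lemma coefD f g k : circle_continuous f -> circle_continuous g ->
  coef (fun x => f x + g x) k = coef f k + coef g k.
Proof.
move=> cf cg; rewrite -meanD; try exact: circle_continuousM (circle_continuous_exprz _).
by apply: eq_mean => x _; rewrite mulrDl.
Qed.

Lemma coefZ (c : C) f k : circle_continuous f -> coef (fun x => c * f x) k = c * coef f k.
Proof.
move=> cf; rewrite -meanZ; last exact: circle_continuousM (circle_continuous_exprz _).
by apply: eq_mean => x _; rewrite mulrA.
Qed.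

Lemma eq_coef f g k : (forall x, x != 0 -> f x = g x) -> coef f k = coef g k.
Proof. by move=> fg; apply: eq_mean => x x0; rewrite fg. Qed.

Lemma coef_shift f m k : coef (fun x => x ^ m * f x) k = coef f (k - m).
Proof.
by apply: eq_mean => x x0; rewrite opprB expfzDr // mulrA [f x * _]mulrC.
Qed.

Lemma coef_dilate f y k : holomorphic f -> y != 0 ->
  coef (fun x => f (y * x)) k = y ^ k * coef f k.
Proof.
move=> df y0.
have dg : holomorphic (fun x => f x * x ^ (- k)) by exact: holomorphicM (holomorphic_exprz _).
rewrite /coef -(mean_dilate dg y0) -meanZ.
  apply: eq_mean => x x0; rewrite expfzMl mulrCA [y ^ k * _]mulrA -expfzDr // addrN.
  by rewrite expr0z mul1r.
apply: holomorphic_circle; apply: (holomorphic_comp dg).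
  by apply: holomorphicM; [exact: holomorphic_cst|move=> z _; exact: cderivable_id].
by move=> z z0; rewrite mulf_neq0.
Qed.

Lemma coef_inv f k : holomorphic f -> coef (fun x => f x^-1) k = coef f (- k).
Proof.
move=> df; rewrite /coef opprK.
rewrite -(mean_inv (f := fun x => f x * x ^ k)); last exact: holomorphicM (holomorphic_exprz _).
by apply: eq_mean => x x0; rewrite exprz_inv.
Qed.

Lemma coef_exprz m k : coef (fun x => x ^ m) k = if k == m then period%:C else 0.
Proof.
have -> : coef (fun x => x ^ m) k = mean (fun x => x ^ (m - k)).
  by apply: eq_mean => x x0; rewrite -expfzDr.
have [->|km] := eqVneq k m.
  by rewrite subrr (eq_mean (g := fun=> 1)) ?mean_cst ?mul1r.
(* dilating by 2 multiplies the mean of x ^ (m - k) by 2 ^ (m - k), which is not 1 *)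
have two0 : (2 : C) != 0 by rewrite pnatr_eq0.
have := mean_dilate (holomorphic_exprz (m - k)) two0.
rewrite (eq_mean (g := fun x => 2 ^ (m - k) * x ^ (m - k))); last first.
  by move=> x _; rewrite expfzMl.
rewrite meanZ; last exact: circle_continuous_exprz.
move=> /eqP; rewrite -subr_eq0 -[X in _ - X]mul1r -mulrBl mulf_eq0 => /orP[|/eqP//].
rewrite subr_eq0 => /eqP h; exfalso.
have : (2 : C) ^ `|m - k|%N = 1.
  have [e|e] : m - k = `|m - k|%N \/ m - k = - `|m - k|%N%:Z by lia.
    by rewrite -e.
  by apply/eqP; rewrite -invr_eq1 invr_expz -e h.
have : (0 < `|m - k|)%N by rewrite absz_gt0 subr_eq0 eq_sym.
case: (`|m - k|%N) => // n _ /eqP; rewrite -exprnP -natrX -[1]/(1%:R) eqr_nat.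
by rewrite expnS; have := expn_gt0 2 n; lia.
Qed.

(** Bessel's inequality, in the form: a value c shared by infinitely many Fourier
coefficients of a continuous function is 0.  Subtracting from h the orthogonal
terms c x^k one after the other decreases its square norm by |c|^2 each time. *)
Lemma bessel h (c : C) (m : nat -> int) : circle_continuous h -> injective m ->
  (forall i, coef h (m i) = c) -> c = 0.
Proof.
move=> ch injm hm; pose T : C := period%:C.
have T0 : T != 0 by rewrite (inj_eq (@complexI R)) gt_eqF ?period_gt0.
pose a := c / T.
pose H := fix H n : C -> C := if n is n'.+1 then fun x => H n' x + (- a) * x ^ m n' else h.
have cH n : circle_continuous (H n).
  elim: n => [//|n IH] /=; apply: circle_continuousD IH _.
  by apply: circle_continuousM (circle_continuous_exprz _); exact: circle_continuous_cst.
have coefH n i : (n <= i)%N -> coef (H n) (m i) = c.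
  elim: n => [//|n IH] ni; rewrite /= coefD //; last first.
    by apply: circle_continuousM (circle_continuous_exprz _); exact: circle_continuous_cst.
  rewrite coefZ ?coef_exprz ?(inj_eq injm); last exact: circle_continuous_exprz.
  by rewrite gtn_eqF // mulr0 addr0 IH // ltnW.
pose Q n := mean (fun x => H n x * conjc (H n x)).
have cHc n : circle_continuous (fun x => conjc (H n x)) by exact: circle_continuous_conj.
have step n : Q n.+1 = Q n - c * conjc c / T.
  pose e x : C := x ^ (m n); pose e' x : C := x ^ (- m n).
  have ce : circle_continuous e by exact: circle_continuous_exprz.
  have ce' : circle_continuous e' by exact: circle_continuous_exprz.
  have A1 : mean (fun x => H n x * e' x) = c by exact: coefH.
  have conj_e v : conjc (e (cexp 0 v)) = e' (cexp 0 v).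
    by rewrite /e /e' -exprz_inv -conj_cexp; case: (m n) => k;
       rewrite ?NegzE -?exprnN ?rmorphXn ?fmorphV ?rmorphXn.
  have A2 : mean (fun x => e x * conjc (H n x)) = conjc c.
    rewrite -A1 -mean_conj; last exact: circle_continuousM.
    apply: cint_ext => v; rewrite rmorphM /= -conj_e mulrC; congr (_ * _).
    by rewrite conjcK.
  rewrite /Q.
  have -> : mean (fun x => H n.+1 x * conjc (H n.+1 x)) =
     mean (fun x => (H n x * conjc (H n x) + (- a) * (e x * conjc (H n x))) +
            ((- conjc a) * (H n x * e' x) + a * conjc a)).
    apply: cint_ext => v; rewrite /= rmorphD rmorphM rmorphN /= -/(e _) conj_e.
    have ee : e (cexp 0 v) * e' (cexp 0 v) = 1.
      by rewrite /e /e' -expfzDr ?cexp_neq0 // subrr expr0z.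
    have -> : forall p q r s t u : C, (p + (- q) * r) * (s + (- t) * u) =
      (p * s + (- q) * (r * s)) + ((- t) * (p * u) + (q * t) * (r * u)) by move=> *; ring.
    by rewrite ee mulr1.
  have ca (d : C) g : circle_continuous g -> circle_continuous (fun x => d * g x).
    by move=> cg; apply: circle_continuousM cg; exact: circle_continuous_cst.
  rewrite meanD; last 2 first.
  - apply: circle_continuousD; first exact: circle_continuousM.
    by apply: ca; exact: circle_continuousM.
  - apply: circle_continuousD; last exact: circle_continuous_cst.
    by apply: ca; exact: circle_continuousM.
  rewrite meanD; last 2 first.
  - exact: circle_continuousM.
  - by apply: ca; exact: circle_continuousM.
  rewrite meanD; last 2 first.
  - by apply: ca; exact: circle_continuousM.
  - exact: circle_continuous_cst.
  have ac : conjc a = conjc c / T.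
    by rewrite /a rmorphM fmorphV; congr (_ / _); exact: conjc_real.
  rewrite (meanZ (- a) (circle_continuousM ce (cHc n))).
  rewrite (meanZ (- conjc a) (circle_continuousM (cH n) ce')).
  rewrite A1 A2 mean_cst -/T ac /a -/(Q n).
  by field.
have Qn n : Q n = Q 0%N - (c * conjc c / T) *+ n.
  elim: n => [|n IH]; first by rewrite mulr0n subr0.
  by rewrite step IH mulrSr; ring.
have Q0 n : 0 <= complex.Re (Q n).
  apply: Re_cint_ge0; first exact: ltW period_gt0.
    exact: (circle_continuousM (cH n) (cHc n)).
  by move=> v; case: (H n _) => x y /=; rewrite mulrN opprK addr_ge0 // -expr2 sqr_ge0.
pose N := complex.Re c ^+ 2 + complex.Im c ^+ 2.
have cc : c * conjc c / T = (N / period)%:C.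
  rewrite rmorphM fmorphV /=; congr (_ / _); rewrite /N; case: (c) => x y /=.
  by apply/eqP; rewrite eq_complex /=; apply/andP; split; apply/eqP; ring.
have bd n : (N / period) *+ n <= complex.Re (Q 0%N).
  have := Q0 n; rewrite Qn cc ReD ReN subr_ge0.
  by rewrite -rmorphMn.
have N0 : 0 <= N by rewrite addr_ge0 ?sqr_ge0.
suff : N = 0.
  move=> /eqP; rewrite paddr_eq0 ?sqr_ge0 // !sqrf_eq0 => h0.
  by apply/eqP; rewrite eq_complex.
apply/eqP; rewrite eq_le N0 andbT leNgt; apply/negP => Npos.
pose d := N / period; have d0 : 0 < d by rewrite divr_gt0 ?period_gt0.
have := bd (Num.truncn (complex.Re (Q 0%N) / d)).+1.
rewrite leNgt => /negP; apply.
by rewrite -mulr_natr mulrC -ltr_pdivrMr // truncnS_gt.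
Qed.

(** The slope phi of f at 1 is continuous on the circle, and the coefficients of
f = f(1) + (x - 1) phi are the successive differences of those of phi, up to the
constant term; so if the coefficients of f vanish, those of phi are constant on each
half-line, hence vanish by Bessel, and the constant term of f is a multiple of f(1). *)
Lemma coef_eq0_at1 f : holomorphic f -> (forall k, coef f k = 0) -> f 1 = 0.
Proof.
move=> df f0; have [phi cphi fE] := df 1 (oner_neq0 _).
have cph : circle_continuous phi.
  apply: continuous_circle => z z0; have [->//|z1] := eqVneq z 1.
  exact: (slope_continuous (cderivable_continuous (df z z0)) z1 fE).
have rec k : coef f k =
    f 1 * (if k == 0 then period%:C else 0) + coef phi (k - 1) - coef phi k.
  have -> : coef f k = coef (fun x => (f 1 * x ^ 0 + x ^ 1 * phi x) + (-1) * phi x) k.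
    by apply: eq_coef => x x0; rewrite fE expr0z expr1z; ring.
  have c1 : circle_continuous (fun x => f 1 * x ^ 0).
    by apply: circle_continuousM (circle_continuous_exprz _); exact: circle_continuous_cst.
  have c2 : circle_continuous (fun x => x ^ 1 * phi x).
    by apply: circle_continuousM cph; exact: circle_continuous_exprz.
  have c3 : circle_continuous (fun x => (-1) * phi x).
    by apply: circle_continuousM cph; exact: circle_continuous_cst.
  rewrite (coefD _ (circle_continuousD c1 c2) c3) (coefD _ c1 c2) coef_shift.
  by rewrite !coefZ ?coef_exprz ?mulN1r //; exact: circle_continuous_exprz.
have eqk k : k != 0 -> coef phi k = coef phi (k - 1).
  move=> k0; have := rec k; rewrite f0 (negbTE k0) mulr0 add0r => /esym/eqP.
  by rewrite subr_eq0 => /eqP ->.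
have pos (n : nat) : coef phi n = coef phi 0.
  elim: n => [//|n IH]; rewrite eqk // -IH; congr (coef _ _); lia.
have neg (n : nat) : coef phi (- n%:Z - 1) = coef phi (-1).
  elim: n => [//|n IH]; rewrite -IH (eqk (- n%:Z - 1)); last by lia.
  congr (coef _ _); lia.
have p0 : coef phi 0 = 0 by apply: (bessel cph _ pos) => i j []; lia.
have n0 : coef phi (-1) = 0 by apply: (bessel cph _ neg) => i j; lia.
have := rec 0; rewrite f0 eqxx p0 sub0r n0 addr0 subr0 => /esym/eqP.
rewrite mulf_eq0 => /orP[/eqP//|].
by rewrite (inj_eq (@complexI R)) gt_eqF ?period_gt0.
Qed.

(** Uniqueness of the Laurent expansion: dilations reduce the vanishing at y to the
vanishing at 1. *)
Lemma coef_eq0 f : holomorphic f -> (forall k, coef f k = 0) ->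
  forall y, y != 0 -> f y = 0.
Proof.
move=> df f0 y y0; rewrite -[y]mulr1.
apply: (coef_eq0_at1 (f := fun x => f (y * x))) => [|k].
  apply: (holomorphic_comp df); last by move=> z z0; rewrite mulf_neq0.
  by apply: holomorphicM; [exact: holomorphic_cst|move=> z _; exact: cderivable_id].
by rewrite coef_dilate // f0 mulr0.
Qed.

End FourierCoefficients.

(** * The q-Pochhammer symbol *)

Section Pochhammer.
Local Open Scope classical_set_scope.
Variable R : realType.
Local Notation C := R[i].
Implicit Types (x h : C) (A b : nat -> C).

Definition cconverges A (l : C) := ((A : nat -> C^o) @ \oo --> (l : C^o)).

Lemma cconvergesL1 A l : cconverges A l <->
  forall e : R, 0 < e -> \forall n \near \oo, L1 (A n - l) < e.
Proof.
split=> [/cvgrPdist_lt h e e0|h].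
- have e2 : 0 < (e / 2)%:C by rewrite ltcR divr_gt0.
  near=> n; have : `|l - A n| < (e / 2)%:C by near: n; exact: h.
  rewrite distrC => hlt; rewrite -ltcR; apply: le_lt_trans (L1_le_norm _) _.
  by move: hlt; rewrite rmorphM /= fmorphV rmorph_nat ltr_pdivlMr // mulrC.
- apply/cvgrPdist_lt => e e0.
  have eE : e = (complex.Re e)%:C by rewrite RRe_real // gtr0_real.
  have e1 : 0 < complex.Re e by rewrite -ltcR -eE.
  near=> n; rewrite distrC; apply: le_lt_trans (norm_le_L1 _) _.
  by rewrite eE ltcR; near: n; exact: h.
Unshelve. all: by end_near. Qed.

Lemma cconverges_uniq A l l' : cconverges A l -> cconverges A l' -> l = l'.
Proof. by move=> h h'; apply: (cvg_unique _ h h'); exact: norm_hausdorff. Qed.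

Lemma cconvergesD A b l m : cconverges A l -> cconverges b m ->
  cconverges (fun n => A n + b n) (l + m).
Proof. by move=> h h'; exact: (@cvgD C C^o _ _ _ _ _ _ _ h h'). Qed.

Lemma cconvergesM A b l m : cconverges A l -> cconverges b m ->
  cconverges (fun n => A n * b n) (l * m).
Proof. by move=> h h'; exact: (@cvgM C _ _ _ _ _ _ _ h h'). Qed.

Lemma cconverges_cst l : cconverges (fun=> l) l.
Proof. exact: cvg_cst. Qed.

Lemma cconvergesS A l : cconverges A l -> cconverges (fun n => A n.+1) l.
Proof. by move=> h; rewrite /cconverges (cvg_shiftS (A : nat -> C^o)). Qed.

Lemma cconverges_lim A l : cconverges A l -> lim ((A : nat -> C^o) @ \oo) = l.
Proof. by move=> h; apply: (cvg_lim _ h); exact: norm_hausdorff. Qed.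

Lemma cconverges_bound A l (K : R) : cconverges A l -> (forall n, L1 (A n) <= K) -> L1 l <= K.
Proof.
move=> /cconvergesL1 h hK; apply/ler_addgt0Pr => e e0.
have [N _ hN] := h e e0; have := hN N (leqnn N).
rewrite L1B => /ltW hl; apply: le_trans (L1_dist l (A N)) _.
by rewrite lerD.
Qed.

Lemma geometric_sum_le (rho : R) n : 0 <= rho < 1 -> \sum_(i < n) rho ^+ i <= (1 - rho)^-1.
Proof.
move=> /andP[r0 r1]; have h : 0 < 1 - rho by rewrite subr_gt0.
rewrite -[leRHS]mul1r ler_pdivlMr // mulrC -opprB mulNr -subrX1 opprB.
by rewrite gerBl exprn_ge0.
Qed.

(** Adding to a the partial sums s of the geometric series that dominates its increments
makes it nondecreasing, so a is a difference of bounded monotone sequences. *)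
Lemma real_geometric_cvg (a : nat -> R) (K B rho : R) : 0 <= rho < 1 -> 0 <= K ->
  (forall n, `|a n| <= B) -> (forall n, `|a n.+1 - a n| <= K * rho ^+ n) ->
  exists l : R, a @ \oo --> l.
Proof.
move=> hr K0 aB ha; have /andP[r0 r1] := hr.
pose s n := K * \sum_(i < n) rho ^+ i.
have sS n : s n.+1 = s n + K * rho ^+ n by rewrite /s big_ord_recr mulrDr.
have sB n : s n <= K / (1 - rho) by rewrite ler_wpM2l // geometric_sum_le.
have cs : cvgn s.
  apply: nondecreasing_is_cvgn; last by exists (K / (1 - rho)) => _ [n _ <-].
  by apply/nondecreasing_seqP => n; rewrite sS lerDl mulr_ge0 ?exprn_ge0.
have cu : cvgn (a + s).
  apply: nondecreasing_is_cvgn.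
    apply/nondecreasing_seqP => n; rewrite !fctE sS.
    by have := ha n; rewrite ler_norml => /andP[h _]; lra.
  exists (B + K / (1 - rho)) => _ [n _ <-]; rewrite !fctE lerD //.
  exact: le_trans (ler_norm _) (aB n).
exists (limn (a + s) - limn s).
suff : (a + s - s) @ \oo --> limn (a + s) - limn s by rewrite addrK.
exact: cvgB.
Qed.

Lemma complex_geometric_cvg A (K B rho : R) : 0 <= rho < 1 -> 0 <= K ->
  (forall n, L1 (A n) <= B) -> (forall n, L1 (A n.+1 - A n) <= K * rho ^+ n) ->
  exists l, cconverges A l.
Proof.
move=> hr K0 AB hA.
have [l1 h1] : exists l : R, (fun n => complex.Re (A n)) @ \oo --> l.
  apply: (real_geometric_cvg hr K0 (B := B)) => n; first exact: le_trans (Re_le_L1 _) (AB n).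
  by rewrite -ReN -ReD; exact: le_trans (Re_le_L1 _) (hA n).
have [l2 h2] : exists l : R, (fun n => complex.Im (A n)) @ \oo --> l.
  apply: (real_geometric_cvg hr K0 (B := B)) => n; first exact: le_trans (Im_le_L1 _) (AB n).
  by rewrite -ImN -ImD; exact: le_trans (Im_le_L1 _) (hA n).
exists (l1 +i* l2); apply/cconvergesL1 => e e0.
have e2 : 0 < e / 2 by rewrite divr_gt0.
move/cvgrPdist_lt: h1 => /(_ _ e2) h1; move/cvgrPdist_lt: h2 => /(_ _ e2) h2.
near=> n; rewrite L1B /L1 ReD ReN ImD ImN [e]splitr.
by rewrite ltrD //; near: n.
Unshelve. all: by end_near. Qed.

Variable q : C.
Hypothesis q1 : `|q| < 1.

Let rho := complex.Re `|q|.

Let normq : `|q| = rho%:C.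
Proof. by rewrite /rho RRe_real // normr_real. Qed.

Let rho01 : 0 <= rho < 1.
Proof. by rewrite -lecR -normq normr_ge0 -ltcR -normq. Qed.

Let L1q n : L1 (q ^+ n) <= 2 * rho ^+ n.
Proof.
rewrite -lecR; apply: le_trans (L1_le_norm _) _.
by rewrite normrX normq rmorphM rmorphXn /= rmorph_nat.
Qed.

(** The recursion shared by the partial products of the q-Pochhammer symbol and by
their first and second order Taylor coefficients: its solutions are bounded,
locally uniformly in x, and convergent. *)
Lemma recursion_bound (X B a0 : R) : 0 <= X -> 0 <= B -> 0 <= a0 ->
  exists2 K : R, 0 <= K & forall x A b, L1 x <= X -> (forall n, L1 (b n) <= B) ->
    L1 (A 0%N) <= a0 -> (forall n, A n.+1 = A n * (1 - x * q ^+ n) - q ^+ n * b n) ->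
    forall n, L1 (A n) <= K.
Proof.
move=> X0 B0 a00; pose c := 2 * (X + B).
have /andP[r0 r1] := rho01.
have c0 : 0 <= c by rewrite mulr_ge0 ?addr_ge0.
(* L1 (A n) + 1 is multiplied at each step by at most 1 + c rho^n <= exp (c rho^n) *)
exists ((a0 + 1) * expR (c * (1 - rho)^-1)).
  by rewrite mulr_ge0 ?expR_ge0 ?addr_ge0.
move=> x A b hx hb hA rec n.
have main m : L1 (A m) + 1 <= (a0 + 1) * expR (c * \sum_(i < m) rho ^+ i).
  elim: m => [|m IH]; first by rewrite big_ord0 mulr0 expR0 mulr1 lerD2r.
  rewrite big_ord_recr /= mulrDr expRD mulrA.
  have cr : 0 <= c * rho ^+ m by rewrite mulr_ge0 ?exprn_ge0.
  apply: le_trans (_ : (L1 (A m) + 1) * (1 + c * rho ^+ m) <= _); last first.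
    apply: ler_pM => //; first by rewrite addr_ge0 ?L1_ge0.
      by rewrite addr_ge0.
    exact: expR_ge1Dx.
  have b1 : L1 (A m * (x * q ^+ m)) <= L1 (A m) * (X * (2 * rho ^+ m)).
    apply: le_trans (L1M _ _) _; rewrite ler_wpM2l ?L1_ge0 //.
    by apply: le_trans (L1M _ _) _; apply: ler_pM; rewrite ?L1_ge0.
  have b2 : L1 (q ^+ m * b m) <= 2 * rho ^+ m * B.
    by apply: le_trans (L1M _ _) _; apply: ler_pM; rewrite ?L1_ge0.
  have -> : A m.+1 = A m + - (A m * (x * q ^+ m)) + - (q ^+ m * b m).
    by rewrite rec; ring.
  have h1 := L1D (A m + - (A m * (x * q ^+ m))) (- (q ^+ m * b m)).
  have h2 := L1D (A m) (- (A m * (x * q ^+ m))).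
  rewrite L1N in h1; rewrite L1N in h2.
  have e : (L1 (A m) + 1) * (1 + c * rho ^+ m) = L1 (A m) + 1 +
     L1 (A m) * (X * (2 * rho ^+ m)) + 2 * rho ^+ m * B +
     (L1 (A m) * (2 * rho ^+ m * B) + 2 * rho ^+ m * X).
    by rewrite /c; ring.
  have p1 : 0 <= L1 (A m) * (2 * rho ^+ m * B).
    by rewrite !mulr_ge0 ?L1_ge0 ?exprn_ge0.
  have p2 : 0 <= 2 * rho ^+ m * X by rewrite !mulr_ge0 ?exprn_ge0.
  by move: h1 h2 b1 b2 p1 p2; rewrite e; lra.
apply: le_trans (_ : L1 (A n) + 1 <= _); first by rewrite lerDl.
apply: le_trans (main n) _; rewrite ler_wpM2l ?addr_ge0 // ler_expR ler_wpM2l //.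
exact: geometric_sum_le.
Qed.

Lemma recursion_cvg x A b (B : R) : (forall n, L1 (b n) <= B) ->
  (forall n, A n.+1 = A n * (1 - x * q ^+ n) - q ^+ n * b n) ->
  exists l, cconverges A l.
Proof.
move=> hb rec; have B0 : 0 <= B by apply: le_trans (hb 0%N); exact: L1_ge0.
have [K K0 hK] := recursion_bound (L1_ge0 x) B0 (L1_ge0 (A 0%N)).
have AK n : L1 (A n) <= K by apply: (hK x A b).
apply: (complex_geometric_cvg (K := 2 * (K * L1 x + B)) rho01 _ AK).
  by rewrite mulr_ge0 // addr_ge0 ?mulr_ge0 ?L1_ge0.
move=> n; have -> : A n.+1 - A n = (- (A n * x) - b n) * q ^+ n by rewrite rec; ring.
apply: le_trans (L1M _ _) _.
have -> : 2 * (K * L1 x + B) * rho ^+ n = (K * L1 x + B) * (2 * rho ^+ n) by ring.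
apply: ler_pM; rewrite ?L1_ge0 //.
apply: le_trans (L1D _ _) _; rewrite !L1N lerD //.
by apply: le_trans (L1M _ _) _; rewrite ler_wpM2r ?L1_ge0.
Qed.

Let P x n := \prod_(0 <= j < n) (1 - x * q ^+ j).

Let PS x n : P x n.+1 = P x n * (1 - x * q ^+ n).
Proof. by rewrite /P big_nat_recr. Qed.

Let P_rec x n : P x n.+1 = P x n * (1 - x * q ^+ n) - q ^+ n * 0.
Proof. by rewrite PS mulr0 subr0. Qed.

Lemma qpochhammer_cvg x :
  cconverges (fun n => \prod_(0 <= j < n) (1 - x * q ^+ j)) (qpochhammer x q).
Proof.
have [|l hl] := @recursion_cvg x (P x) (fun=> 0) 0 _ (P_rec x).
  by move=> n; rewrite L1_0.
by rewrite /qpochhammer (cconverges_lim hl).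
Qed.

Lemma qpochhammerS x : qpochhammer x q = (1 - x) * qpochhammer (q * x) q.
Proof.
apply: (cconverges_uniq (cconvergesS (@qpochhammer_cvg x))).
have -> : (fun n => \prod_(0 <= j < n.+1) (1 - x * q ^+ j)) =
    (fun n => (1 - x) * \prod_(0 <= j < n) (1 - q * x * q ^+ j)).
  apply/funext => n; rewrite big_nat_recl // expr0 mulr1; congr (_ * _).
  by apply: eq_bigr => j _; rewrite exprS; congr (1 - _); ring.
exact: cconvergesM (@cconverges_cst _) (@qpochhammer_cvg _).
Qed.

Lemma qpochhammer0 : qpochhammer 0 q = 1.
Proof.
apply: (cconverges_uniq (@qpochhammer_cvg 0)).
have -> : (fun n => \prod_(0 <= j < n) (1 - 0 * q ^+ j)) = (fun=> 1).
  by apply/funext => n; rewrite big1 // => j _; rewrite mul0r subr0.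
exact: cconverges_cst.
Qed.

Lemma qpochhammer1 : qpochhammer 1 q = 0.
Proof. by rewrite qpochhammerS subrr mul0r. Qed.

Let D x := fix D n : C := if n is m.+1 then D m * (1 - x * q ^+ m) - q ^+ m * P x m else 0.

Let S x h := fix S n : C :=
  if n is m.+1 then S m * (1 - (x + h) * q ^+ m) - q ^+ m * D x m else 0.

Let taylor x h n : P (x + h) n = P x n + h * D x n + h ^+ 2 * S x h n.
Proof.
elim: n => [|n IH]; first by rewrite /P !big_nil !mulr0 !addr0.
by rewrite !PS IH /=; ring.
Qed.

(** The partial products satisfy P(x + h) = P(x) + h D(x) + h^2 S(x, h), with D and S
solutions of recursions of the type above.  So this expansion passes to the limit
with a remainder S that is bounded for small h, which gives differentiability without
differentiating a limit. *)
Lemma cderivable_qpochhammer x : cderivable (fun x => qpochhammer x q) x.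
Proof.
have [K K0 hK] := recursion_bound (L1_ge0 x) (lexx 0) ler01.
have PK n : L1 (P x n) <= K.
  apply: (hK x (P x) (fun=> 0)) (P_rec x) n => // [n|]; first by rewrite L1_0.
  by rewrite /P big_nil L1_1.
have [K' K'0 hK'] := recursion_bound (L1_ge0 x) K0 (lexx 0).
have DK n : L1 (D x n) <= K' by apply: (hK' x _ (P x)) => //; rewrite L1_0.
have [l hl] : exists l, cconverges (D x) l by apply: (@recursion_cvg x _ (P x) K).
have [K2 K20 hK2] := recursion_bound (addr_ge0 (L1_ge0 x) ler01) K'0 (lexx 0).
have SK h n : L1 h <= 1 -> L1 (S x h n) <= K2.
  move=> h1; apply: (hK2 (x + h) _ (D x)) => //; last by rewrite L1_0.
  by apply: le_trans (L1D _ _) _; rewrite lerD2l.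
have hS h : exists m, cconverges (S x h) m by apply: (@recursion_cvg (x + h) _ (D x) K').
pose s h := sval (cid (hS h)).
have sP h : cconverges (S x h) (s h) by rewrite /s; case: (cid _).
have sK h : L1 h <= 1 -> L1 (s h) <= K2.
  by move=> h1; apply: (cconverges_bound (sP h)) => n; exact: SK.
exists (fun w => l + (w - x) * s (w - x)); last first.
  move=> w; set h := w - x; have -> : w = x + h by rewrite /h subrKC.
  apply: (cconverges_uniq (@qpochhammer_cvg (x + h))).
  have -> : (fun n => \prod_(0 <= j < n) (1 - (x + h) * q ^+ j)) =
      (fun n => (P x n + h * D x n) + h ^+ 2 * S x h n).
    by apply/funext => n; exact: taylor.
  have -> : qpochhammer x q + h * (l + h * s h) =
      qpochhammer x q + h * l + h ^+ 2 * s h by ring.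
  apply: cconvergesD; last exact: cconvergesM (@cconverges_cst _) (sP h).
  exact: cconvergesD (@qpochhammer_cvg x) (cconvergesM (@cconverges_cst _) hl).
apply/continuousL1 => e e0.
have K21 : 0 < K2 + 1 by rewrite ltr_wpDl.
exists (Num.min 1 (e / (K2 + 1))); first by rewrite lt_min ltr01 divr_gt0.
move=> w; rewrite lt_min ltr_pdivlMr // => /andP[/ltW w1 w2].
have -> : l + (w - x) * s (w - x) - (l + (x - x) * s (x - x)) = (w - x) * s (w - x) by ring.
apply: le_lt_trans (L1M _ _) (le_lt_trans _ w2).
rewrite ler_wpM2l ?L1_ge0 //; apply: le_trans (sK _ w1) _.
by rewrite lerDl.
Qed.

Lemma qpochhammer_expand x m : qpochhammer x q = P x m * qpochhammer (q ^+ m * x) q.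
Proof.
elim: m => [|m IH]; first by rewrite /P big_nil expr0 !mul1r.
rewrite IH qpochhammerS PS exprS -!mulrA; congr (_ * _).
by rewrite mulrA [x * _]mulrC.
Qed.

(** Near 0 the symbol is close to 1; the first factors, which are nonzero, bring any x of
the unit disk into that neighbourhood. *)
Lemma qpochhammer_neq0 x : `|x| < 1 -> qpochhammer x q != 0.
Proof.
move=> x1; have /cderivable_continuous/continuousL1/(_ 1 ltr01)[d d0 hd] := cderivable_qpochhammer 0.
have /andP[r0 r1] := rho01.
have [m hm] : exists m, L1 (q ^+ m * x) < d.
  have xx : 0 < 2 * (L1 x + 1) by rewrite mulr_gt0 // ltr_wpDl ?L1_ge0.
  have : (fun n => rho ^+ n) @ \oo --> (0 : R) by apply: cvg_expr; rewrite ger0_norm.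
  move/cvgrPdist_lt => /(_ (d / (2 * (L1 x + 1)))); rewrite divr_gt0 // => /(_ isT)[m _ hm].
  exists m; have := hm m (leqnn m); rewrite sub0r normrN ger0_norm ?exprn_ge0 //.
  rewrite ltr_pdivlMr // => h; apply: le_lt_trans (L1M _ _) (le_lt_trans _ h).
  apply: le_trans (_ : 2 * rho ^+ m * (L1 x + 1) <= _); last by rewrite mulrA [2 * _]mulrC.
  by apply: ler_pM; rewrite ?L1_ge0 ?lerDl.
rewrite (qpochhammer_expand x m) mulf_neq0 //.
  rewrite /P prodf_seq_neq0; apply/allP => j _ /=; rewrite subr_eq0 eq_sym.
  apply/eqP => h; have : `|x * q ^+ j| < 1.
    rewrite normrM normrX; apply: le_lt_trans x1; rewrite ler_piMr //.
    by rewrite exprn_ile1 // ltW.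
  by rewrite h normr1 ltxx.
apply/eqP => h; have := hd (q ^+ m * x); rewrite subr0 => /(_ hm).
by rewrite h qpochhammer0 sub0r L1N L1_1 ltxx.
Qed.

End Pochhammer.

(** * Antisymmetric products over pairs *)

Section AntisymmetricProducts.
Variable K : numFieldType.
Variable n : nat.
Implicit Types (s : 'S_n) (F u : 'I_n -> 'I_n -> K).

(** A permutation of the indices permutes the unordered pairs; those whose order it
reverses are handled by the symmetry of u. *)
Lemma prod_pairs_sym u s : (forall i j, i != j -> u j i = u i j) ->
  \prod_(i < n) \prod_(j < n | (i < j)%N) u (s i) (s j) =
  \prod_(i < n) \prod_(j < n | (i < j)%N) u i j.
Proof.
move=> usym; rewrite !pair_big_dep /=.
pose sp (p : 'I_n * 'I_n) := ((s^-1)%g p.1, (s^-1)%g p.2).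
have spK : cancel sp (fun p => (s p.1, s p.2)) by case=> i j; rewrite /sp /= !permKV.
have Ksp : cancel (fun p => (s p.1, s p.2)) sp by case=> i j; rewrite /sp /= !permK.
rewrite (reindex sp) /=; last by exists (fun p => (s p.1, s p.2)) => p _; [exact: spK|exact: Ksp].
under eq_bigr do rewrite !permKV.
rewrite (bigID (fun p : 'I_n * 'I_n => (p.1 < p.2)%N)) /=.
rewrite [RHS](bigID (fun p : 'I_n * 'I_n => ((s^-1)%g p.1 < (s^-1)%g p.2)%N)) /=.
congr (_ * _); first by apply: eq_bigl => p; rewrite andbC.
pose sw (p : 'I_n * 'I_n) := (p.2, p.1).
have swK : cancel sw sw by case.
rewrite (reindex sw) /=; last by exists sw => p _; exact: swK.
apply: eq_big => [[i j]|[i j]] /=.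
  have [->|ij] := eqVneq i j; first by rewrite !ltnn.
  have sij : (s^-1)%g i != (s^-1)%g j :> nat.
    by apply: contra ij => /eqP/val_inj/perm_inj ->.
  by have : (i : nat) != j := ij; lia.
move=> /andP[lt_s _]; apply: usym; apply/eqP => ij.
by move: lt_s; rewrite ij ltnn.
Qed.

(** The sign of a permutation is compared with the Vandermonde determinant of the
points 0, 1, ..., n - 1: dividing F by its factors leaves a symmetric function. *)
Lemma prod_pairs_antisym F s : (forall i j, i != j -> F j i = - F i j) ->
  \prod_(i < n) \prod_(j < n | (i < j)%N) F (s i) (s j) =
  (-1) ^+ s * \prod_(i < n) \prod_(j < n | (i < j)%N) F i j.
Proof.
move=> Fanti; pose G (i j : 'I_n) : K := j%:R - i%:R.
have G0 i j : i != j -> G i j != 0.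
  by move=> ij; rewrite subr_eq0 eqr_nat eq_sym.
have FE (s' : 'S_n) : \prod_(i < n) \prod_(j < n | (i < j)%N) F (s' i) (s' j) =
    (\prod_(i < n) \prod_(j < n | (i < j)%N) (F (s' i) (s' j) / G (s' i) (s' j))) *
    (\prod_(i < n) \prod_(j < n | (i < j)%N) G (s' i) (s' j)).
  rewrite -big_split /=; apply: eq_bigr => i _; rewrite -big_split /=.
  apply: eq_bigr => j ij; rewrite divfK // G0 // (inj_eq perm_inj).
  by apply/eqP => e; move: ij; rewrite e ltnn.
have GE (s' : 'S_n) : \prod_(i < n) \prod_(j < n | (i < j)%N) G (s' i) (s' j) =
    \det (Vandermonde n (\row_j (s' j)%:R : 'rV[K]_n)).
  by rewrite det_Vandermonde; apply: eq_bigr => i _; apply: eq_bigr => j _; rewrite !mxE.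
have VE : Vandermonde n (\row_j (s j)%:R : 'rV[K]_n) =
    col_perm s (Vandermonde n (\row_j ((1%g : 'S_n) j)%:R)).
  by apply/matrixP => i j; rewrite !mxE perm1.
have -> : \prod_(i < n) \prod_(j < n | (i < j)%N) F i j =
    \prod_(i < n) \prod_(j < n | (i < j)%N) F ((1%g : 'S_n) i) ((1%g : 'S_n) j).
  by apply: eq_bigr => i _; apply: eq_bigr => j _; rewrite !perm1.
rewrite !FE !GE VE col_permE det_mulmx det_perm.
rewrite !(prod_pairs_sym (u := fun i j => F i j / G i j)); last 2 first.
- by move=> i j ij; rewrite Fanti // /G -[in RHS]opprB invrN mulrN mulNr.
- by move=> i j ij; rewrite Fanti // /G -[in RHS]opprB invrN mulrN mulNr.
by rewrite odd_permV mulrA mulrC.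
Qed.

End AntisymmetricProducts.

(** * Alternating functions in a separated space *)

Section AlternatingFunctions.
Variables (K : numFieldType) (n : nat).
Implicit Types (x z : 'I_n -> K) (H W : ('I_n -> K) -> K) (V : (K -> K) -> Prop).

Definition update x (i : 'I_n) (y : K) : 'I_n -> K := fun j => if j == i then y else x j.

Lemma update_same x i : update x i (x i) = x.
Proof. by apply/funext => j; rewrite /update; case: eqP => [->|]. Qed.

Lemma update_neq0 x i y : (forall j, x j != 0) -> y != 0 -> forall j, update x i y j != 0.
Proof. by move=> x0 y0 j; rewrite /update; case: ifP. Qed.

Definition alternating H := forall x (s : 'S_n), (forall i, x i != 0) ->
  H (x \o s) = (-1) ^+ s * H x.

Lemma alternating_eq0 H x i j : alternating H -> (forall i, x i != 0) ->
  i != j -> x i = x j -> H x = 0.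
Proof.
move=> altH x0 ij xij; have := altH x (tperm i j) x0.
have -> : x \o tperm i j = x.
  by apply/funext => k /=; case: tpermP => [->|->|].
rewrite odd_tperm ij expr1 mulN1r => /eqP; rewrite -subr_eq0 opprK -mulr2n.
by rewrite mulrn_eq0 /= => /eqP.
Qed.

(** Separation by n linear forms says that V has dimension at most n, once functions
that agree outside 0 are identified, without forming the quotient. *)
Record separated_space V (lam : 'I_n -> (K -> K) -> K) : Prop := SeparatedSpace {
  sep_0 : V (fun=> 0);
  sep_lin : forall a f g, V f -> V g -> V (fun y : K => a * f y + g y);
  sep_lam0 : forall i, lam i (fun=> 0) = 0;
  sep_lam : forall i a f g, V f -> V g ->
    lam i (fun y : K => a * f y + g y) = a * lam i f + lam i g;
  sep_eq0 : forall f, V f -> (forall i, lam i f = 0) -> forall y : K, y != 0 -> f y = 0 }.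

Definition slotwise V H := forall x i, (forall j, x j != 0) -> V (fun y => H (update x i y)).

Section Separated.
Variables (V : (K -> K) -> Prop) (lam : 'I_n -> (K -> K) -> K).
Hypothesis sepV : separated_space V lam.

Lemma sep_sum (I : Type) (r : seq I) (c : I -> K) (e : I -> K -> K) :
  (forall i, V (e i)) -> V (fun y : K => \sum_(i <- r) c i * e i y) /\
  forall j, lam j (fun y : K => \sum_(i <- r) c i * e i y) = \sum_(i <- r) c i * lam j (e i).
Proof.
move=> Ve; elim: r => [|i r [V1 l1]].
  have -> : (fun y : K => \sum_(i <- [::]) c i * e i y) = (fun=> 0).
    by apply/funext => x; rewrite big_nil.
  by split; [exact: (sep_0 sepV)|move=> j; rewrite big_nil (sep_lam0 sepV)].
have -> : (fun y : K => \sum_(k <- i :: r) c k * e k y) =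
    (fun y : K => c i * e i y + \sum_(k <- r) c k * e k y).
  by apply/funext => x; rewrite big_cons.
split; first exact: (sep_lin sepV).
by move=> j; rewrite big_cons (sep_lam sepV) // l1.
Qed.

(** The functions e_i are independent, being dual to the points z_j, so the bound on the
dimension makes them a basis: the matrix of the forms lam_j on the e_i is invertible.
Expanding g in this basis gives its values at the z_k as coordinates. *)
Lemma interpolation (z : 'I_n -> K) (e : 'I_n -> K -> K) :
  (forall i, z i != 0) -> (forall i, V (e i)) -> (forall i j, e i (z j) = (i == j)%:R) ->
  forall g, V g -> (forall k, g (z k) = 0) -> forall y : K, y != 0 -> g y = 0.
Proof.
move=> z0 Ve dual g Vg gz.
have sum_z (c : 'I_n -> K) k : \sum_i c i * e i (z k) = c k.
  rewrite (bigD1 k) //= dual eqxx mulr1 big1 ?addr0 // => i ik.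
  by rewrite dual (negbTE ik) mulr0.
pose M := \matrix_(i, j) lam j (e i).
have Mfree : row_free M.
  apply: inj_row_free => v vM; apply/rowP => k; rewrite mxE.
  rewrite -(sum_z (fun i => v 0 i)).
  have [V1 l1] := sep_sum (index_enum 'I_n) (fun i => v 0 i) Ve.
  apply: (sep_eq0 sepV V1) => // j; rewrite l1.
  have /rowP/(_ j) := vM; rewrite !mxE => h; rewrite -[RHS]h.
  by apply: eq_bigr => i _; rewrite !mxE.
pose c := (\row_j lam j g) *m invmx M.
have cM : c *m M = \row_j lam j g by rewrite mulmxKV // -row_free_unit.
have [V1 l1] := sep_sum (index_enum 'I_n) (fun i => c 0 i) Ve.
have V2 := sep_lin sepV (-1) V1 Vg.
have h := sep_eq0 sepV V2.
have {}h (x : K) : x != 0 -> g x = \sum_i c 0 i * e i x.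
  move=> x0; have := h _ x x0.
  rewrite mulN1r addrC => /(_ _)/eqP; rewrite subr_eq0 => H; apply/eqP/H => j.
  rewrite (sep_lam sepV) // l1 mulN1r; have /rowP/(_ j) := cM.
  rewrite !mxE => <-; apply/eqP; rewrite addrC subr_eq0; apply/eqP.
  by apply: eq_bigr => i _; rewrite !mxE.
move=> x x0; rewrite h // big1 // => k _.
by rewrite -(sum_z (fun i => c 0 i) k) -h // gz mul0r.
Qed.

(** Elements of V are determined by their values at the points z_k, so slot by slot H is
determined by its values at tuples of such points. By alternation these are 0 or, up to
sign, H z. *)
Lemma slotwise_eq0 H (z : 'I_n -> K) : (forall i, z i != 0) ->
  (forall g, V g -> (forall k, g (z k) = 0) -> forall y : K, y != 0 -> g y = 0) ->
  slotwise V H -> alternating H -> H z = 0 ->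
  forall x, (forall i, x i != 0) -> H x = 0.
Proof.
move=> z0 interp slotH altH Hz.
have main k : (k <= n)%N -> forall x, (forall i, x i != 0) ->
    (forall i : 'I_n, (k <= i)%N -> exists m, x i = z m) -> H x = 0.
  elim: k => [_|k IH kn] x x0 hx.
    have [m hm] : exists m : 'I_n -> 'I_n, forall i, x i = z (m i).
      by exists (fun i => sval (cid (hx i (leq0n _)))) => i; case: (cid _).
    have [/injectiveP mi|/injectivePn[i [j ij mij]]] := boolP (injectiveb m).
      have -> : x = z \o perm mi by apply/funext => i; rewrite /= permE hm.
      by rewrite altH // Hz mulr0.
    by apply: (alternating_eq0 altH x0 ij); rewrite !hm mij.
  pose i0 := Ordinal kn; rewrite -(update_same x i0).
  apply: (interp (fun y => H (update x i0 y))) => //; first exact: slotH.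
  move=> m; apply: IH; first exact: ltnW.
    exact: update_neq0.
  move=> i ki; rewrite /update; case: eqP => [_|/eqP ne]; first by exists m.
  apply: hx; have : (i : nat) != k by move: ne; rewrite -val_eqE.
  by move: ki; lia.
by move=> x x0; apply: (main n) => // i; rewrite leqNgt ltn_ord.
Qed.

(** Expansion along row i, whose cofactors do not involve the i-th variable. *)
Lemma slotwise_det (f : 'I_n -> K -> K) : (forall j, V (f j)) ->
  slotwise V (fun x => \det (\matrix_(i < n, j < n) f j (x i))).
Proof.
move=> Vf x i x0.
pose A y := \matrix_(i' < n, j < n) f j (update x i y i').
have -> : (fun y => \det (A y)) =
    (fun y => \sum_j cofactor (A 0) i j * f j y).
  apply/funext => y; rewrite (expand_det_row _ i); apply: eq_bigr => j _.
  rewrite mulrC mxE /update eqxx; congr (_ * _); rewrite /cofactor; congr (_ * \det _).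
  apply/matrixP => k l; rewrite !mxE /update.
  by rewrite eq_sym (negbTE (neq_lift _ _)).
by have [] := sep_sum (index_enum 'I_n) (cofactor (A 0) i) Vf.
Qed.

Lemma alternating_det (f : 'I_n -> K -> K) :
  alternating (fun x => \det (\matrix_(i < n, j < n) f j (x i))).
Proof.
move=> x s _; have -> : \matrix_(i, j) f j ((x \o s) i) = row_perm s (\matrix_(i, j) f j (x i)).
  by apply/matrixP => i j; rewrite !mxE.
by rewrite row_permE det_mulmx det_perm.
Qed.

(** Both sides are alternating with all slots in V, so the combination of them that
vanishes at z is 0. The functions dual to the points of z are obtained from W itself: let
the i-th variable run while the others stay at z, and divide by W z. *)
Lemma det_proportional W (f : 'I_n -> K -> K) (z : 'I_n -> K) :
  slotwise V W -> alternating W -> (forall i, z i != 0) -> W z != 0 ->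
  (forall j, V (f j)) ->
  exists C, forall x, (forall i, x i != 0) ->
    \det (\matrix_(i < n, j < n) f j (x i)) = C * W x.
Proof.
move=> slotW altW z0 Wz Vf.
pose det x := \det (\matrix_(i < n, j < n) f j (x i)).
pose H x := - det z / W z * W x + det x.
have Vscale a g : V g -> V (fun y : K => a * g y).
  move=> Vg; have := sep_lin sepV a Vg (sep_0 sepV).
  by under eq_fun do rewrite addr0.
have slotH : slotwise V H.
  move=> x i x0; apply: (sep_lin sepV); first exact: slotW.
  by have := slotwise_det Vf i x0.
have altH : alternating H.
  move=> x s x0; rewrite /H altW // mulrDr; congr (_ + _); first by rewrite mulrCA.
  exact: alternating_det.
have Hz : H z = 0 by rewrite /H divfK // addNr.
exists (det z / W z) => x x0.
have : H x = 0.
  apply: (slotwise_eq0 z0 _ slotH altH Hz) => //.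
  apply: (interpolation (e := fun i y => (W z)^-1 * W (update z i y))) => //.
    by move=> i; apply: Vscale; exact: slotW.
  move=> i j; have [->|ij] := eqVneq i j; first by rewrite update_same mulVf.
  rewrite (alternating_eq0 (x := update z i (z j)) altW _ ij) ?mulr0 //.
    exact: update_neq0.
  by rewrite /update eqxx eq_sym (negbTE ij).
by rewrite /H mulNr mulNr addrC => /eqP; rewrite subr_eq0 => /eqP.
Qed.

End Separated.
End AlternatingFunctions.

(** * Theta functions *)

Section ThetaFacts.
Variable R : realType.
Local Notation C := R[i].
Variable q : C.
Hypotheses (q0 : q != 0) (q1 : `|q| < 1).
Implicit Types x y a : C.

(** Multiplying by 1 - x turns both sides into products of the same two symbols; at x = 1
both vanish. *)
Lemma thetaq_inv x : x != 0 -> thetaq q x^-1 = - x^-1 * thetaq q x.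
Proof.
move=> x0; rewrite /thetaq invrK; have [->|x1] := eqVneq x 1.
  by rewrite invr1 (qpochhammer1 q1) !mul0r mulr0.
have e1 : 1 - x != 0 by rewrite subr_eq0 eq_sym.
apply: (mulfI e1); rewrite mulrCA -(qpochhammerS q1) (qpochhammerS q1 x^-1).
by rewrite mulrC -/(q / x); field.
Qed.

(** By definition theta(q x) and theta(1/x) are the same product. *)
Lemma thetaq_shift x : x != 0 -> thetaq q (q * x) = - x^-1 * thetaq q x.
Proof.
move=> x0; rewrite -thetaq_inv // /thetaq mulrC invrK; congr (qpochhammer _ q * _).
by rewrite invfM mulrA divff // mul1r.
Qed.

Lemma thetaq_sym x : x != 0 -> thetaq q (q / x) = thetaq q x.
Proof. by move=> x0; rewrite /thetaq mulrC invf_div mulrCA divff // mulr1. Qed.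

Lemma thetaq_neq0 x : `|q| < `|x| -> `|x| < 1 -> thetaq q x != 0.
Proof.
move=> qx x1; have x0 : 0 < `|x| by apply: le_lt_trans qx; exact: normr_ge0.
rewrite mulf_neq0 // qpochhammer_neq0 //.
by rewrite normrM normfV ltr_pdivrMr // mul1r.
Qed.

Lemma holomorphic_thetaq : holomorphic (thetaq q).
Proof.
apply: holomorphicM => [z z0|]; first exact: cderivable_qpochhammer.
have dP : holomorphic (fun x => qpochhammer x q) by move=> z _; exact: cderivable_qpochhammer.
have dV : holomorphic (fun x => q / x).
  by apply: holomorphicM => [|z z0]; [exact: holomorphic_cst|exact: cderivableV].
by apply: (holomorphic_comp dP dV) => z z0; rewrite mulf_neq0 // invr_eq0.
Qed.

End ThetaFacts.

(** * Fourier coefficients of theta functions *)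

Section ThetaSpaces.
Variable R : realType.
Local Notation C := R[i].
Implicit Types (f g : C -> C) (x y a t : C) (k : int).

Lemma holomorphic_puncturedP f : holomorphic_punctured f <-> holomorphic f.
Proof.
by split=> df z z0; [apply: derivable_cderivable|apply: cderivable_derivable]; exact: df.
Qed.

Lemma holomorphic_id : holomorphic (id : C -> C).
Proof. by move=> z _; exact: cderivable_id. Qed.

Lemma holomorphic_lin a f g : holomorphic f -> holomorphic g ->
  holomorphic (fun x => a * f x + g x).
Proof.
move=> df dg z z0.
have [phi cphi fE] := cderivableM (@cderivable_cst R a z) (df z z0).
have [psi cpsi gE] := dg z z0.
exists (fun w => phi w + psi w); first exact: (ccontinuousD cphi cpsi).
by move=> w; rewrite fE gE; ring.
Qed.

Lemma eq_holomorphic f g : (forall x, x != 0 -> f x = g x) -> holomorphic f -> holomorphic g.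
Proof.
move=> fg df z z0; apply: derivable_cderivable.
apply: (@near_eq_derivable C C^o C^o f); last exact/cderivable_derivable/df.
apply/nbhs_ballP; exists `|z|; first by rewrite /= normr_gt0.
move=> w; rewrite -ball_normE /= => hw; apply: fg; apply/eqP => w0.
by move: hw; rewrite w0 subr0 ltxx.
Qed.

Lemma coef_lin a f g k : holomorphic f -> holomorphic g ->
  coef (fun x => a * f x + g x) k = a * coef f k + coef g k.
Proof.
move=> df dg; rewrite -coefZ; last exact: holomorphic_circle.
rewrite coefD //; try exact: holomorphic_circle.
by apply: holomorphic_circle; apply: holomorphicM df; exact: holomorphic_cst.
Qed.

Lemma coef0 k : coef (fun=> 0 : C) k = 0.
Proof.
transitivity (0 * coef (fun=> 0 : C) k); last by rewrite mul0r.
rewrite -coefZ; last exact: circle_continuous_cst.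
by apply: eq_coef => x _; rewrite mul0r.
Qed.

(** A relation between coefficients at distance N transports the vanishing of N
consecutive ones to all of them. *)
Lemma shift_rec_eq0 (p c : C) (N : nat) (u : int -> C) (k0 : int) :
  p != 0 -> c != 0 -> (0 < N)%N ->
  (forall k, p ^ k * u k = c * u (k + N)) ->
  (forall k, k0 <= k < k0 + N -> u k = 0) -> forall k, u k = 0.
Proof.
move=> p0 c0 N0 rec hu.
have step k : u k = 0 <-> u (k + N) = 0.
  split=> h; have := rec k; rewrite h mulr0; last first.
    by move/eqP; rewrite mulf_eq0 expfz_eq0 (negbTE p0) andbF => /eqP.
  by move/esym/eqP; rewrite mulf_eq0 (negbTE c0) => /eqP.
have up (j : nat) k : u k = 0 <-> u (k + (j * N)%N) = 0.
  elim: j => [|j IH]; first by rewrite mul0n addr0.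
  have -> : k + (j.+1 * N)%N = k + (j * N)%N + N by rewrite mulSn; lia.
  exact: (iff_trans IH (step _)).
move=> k; have [r [hr e]] : exists r : int, (0 <= r < N%:Z) /\ exists m : int, k - k0 = m * N + r.
  exists ((k - k0) %% N)%Z; rewrite modz_ge0 ?ltz_pmod //; last by lia.
  by split=> //; exists ((k - k0) %/ N)%Z; exact: divz_eq.
have [m em] := e.
have u0 : u (k0 + r) = 0 by apply: hu; lia.
case: m em => m em.
  have -> : k = k0 + r + (m * N)%N by move: em; rewrite -PoszM; lia.
  exact: (up m _).1 u0.
apply: (up m.+1 k).2; have -> : k + (m.+1 * N)%N = k0 + r; last by [].
by move: em; rewrite NegzE mulNr -PoszM; lia.
Qed.

Variables (p s : C).
Hypotheses (hp : 0 < `|p| < 1) (hs : s ^+ 2 = p).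

Lemma p_neq0 : p != 0.
Proof. by rewrite -normr_gt0; case/andP: hp. Qed.

Lemma p_lt1 : `|p| < 1.
Proof. by case/andP: hp. Qed.

Lemma s_neq0 : s != 0.
Proof. by have := p_neq0; rewrite -hs sqrf_eq0. Qed.

(** The dilation by p multiplies the k-th coefficient by p^k, and the factor x^-N shifts
the index by N. *)
Lemma quasi_period_coef f (c : C) (N : nat) k : holomorphic f ->
  (forall x, x != 0 -> f (p * x) = c * x ^ (- N%:Z) * f x) ->
  p ^ k * coef f k = c * coef f (k + N).
Proof.
move=> df fp; rewrite -(coef_dilate k df p_neq0).
have -> : k + N = k - - N%:Z by rewrite opprK.
rewrite -coef_shift -coefZ; first by apply: eq_coef => x x0; rewrite fp // mulrA.
by apply: holomorphic_circle; apply: holomorphicM df; exact: holomorphic_exprz.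
Qed.

Lemma A_separated n t : t != 0 -> (0 < n)%N ->
  separated_space (A_theta_function p n t) (fun (i : 'I_n) f => coef f i).
Proof.
move=> t0 n0; split.
- split; first exact/holomorphic_puncturedP/holomorphic_cst.
  by move=> x _; rewrite mulr0.
- move=> a f g [/holomorphic_puncturedP df fp] [/holomorphic_puncturedP dg gp].
  split; first exact/holomorphic_puncturedP/holomorphic_lin.
  by move=> x x0; rewrite fp // gp //; ring.
- by move=> i; rewrite coef0.
- move=> i a f g [/holomorphic_puncturedP df _] [/holomorphic_puncturedP dg _].
  exact: coef_lin.
- move=> f [/holomorphic_puncturedP df fp] f0; apply: (coef_eq0 df).
  apply: (@shift_rec_eq0 p ((-1) ^+ n / t) n _ 0) => //; first exact: p_neq0.
  + by rewrite mulf_neq0 ?invr_eq0 // expf_neq0 // oppr_eq0 oner_eq0.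
  + move=> k; apply: quasi_period_coef => // x x0.
    by rewrite fp // invfM -exprnN mulrA.
  + case=> k; last by rewrite NegzE; lia.
    by rewrite add0r => /andP[_ kn]; exact: (f0 (Ordinal (kn : (k < n)%N))).
Qed.

(** The quasi-period of type X is R_const times x^-R_shift. *)
Definition R_shift n (X : root_type) : nat := match X with
  | Bn => 2 * n - 1 | Bnv => 2 * n | Cn => 2 * n + 2 | Cnv => 2 * n | BCn => 2 * n + 1
  | Dn => 2 * n - 2 end.

Definition R_const n (X : root_type) : C := match X with
  | Bn => - (p ^+ (n - 1))^-1 | Bnv => - (p ^+ n)^-1 | Cn => (p ^+ (n + 1))^-1
  | Cnv => (s ^+ (2 * n - 1))^-1 | BCn => (p ^+ n)^-1 | Dn => (p ^+ (n - 1))^-1 end.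

Lemma R_quasi_periodE n X x :
  R_quasi_period p s n X x = R_const n X * x ^ (- (R_shift n X)%:Z).
Proof. by case: X; rewrite /= -exprnN div1r invfM ?mulNr. Qed.

Lemma R_const_neq0 n X : R_const n X != 0.
Proof.
have h (k : nat) : (p ^+ k)^-1 != 0 by rewrite invr_eq0 expf_neq0 // p_neq0.
have h' (k : nat) : (s ^+ k)^-1 != 0 by rewrite invr_eq0 expf_neq0 // s_neq0.
by case: X => /=; rewrite ?oppr_eq0.
Qed.

(** The coefficients that determine a theta function: the symmetry is even about 0 for
D_n, where the constant term is free, and odd about 0 or 1/2 for the other types. *)
Definition R_index (n : nat) (X : root_type) (i : 'I_n) : int :=
  match X with Dn => i%:Z | _ => i%:Z + 1 end.

Definition R_reflect (X : root_type) (u : int -> C) : Prop := match X with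
  | Bn | Cnv | BCn => forall k, u (- k) = - u (k + 1)
  | Bnv | Cn => forall k, u (- k) = - u k
  | Dn => forall k, u (- k) = u k end.

(** The inversion symmetry reflects the n vanishing coefficients into almost a full
period of the recurrence.  For C_n and BC_n one index of the period is left
uncovered: there the recurrence and the reflection contradict each other in sign. *)
Lemma R_coef_eq0 n X (u : int -> C) : (0 < n)%N ->
  (forall k, p ^ k * u k = R_const n X * u (k + R_shift n X)) -> R_reflect X u ->
  (forall i : 'I_n, u (R_index X i) = 0) -> forall k, u k = 0.
Proof.
move=> n0 rec refl hu.
have double0 (z : C) : z = - z -> z = 0.
  by move=> /eqP; rewrite -subr_eq0 opprK -mulr2n mulrn_eq0 => /eqP.
have huN k : X <> Dn -> 1 <= k <= n%:Z -> u k = 0.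
  move=> XD /andP[k1 kn]; have ltk : (`|(k - 1)%R| < n)%N by lia.
  have := hu (Ordinal ltk); have -> : R_index X (Ordinal ltk) = k; last by [].
  by case: X XD {rec refl hu} => // _ /=; lia.
have c0 := R_const_neq0 n X; have p0 := p_neq0.
have refl1 : (forall k, u (- k) = - u (k + 1)) -> X <> Dn ->
    forall k, 1 - n%:Z <= k <= n%:Z -> u k = 0.
  move=> refl1 XD k hk; have [k1|k1] := leP 1 k; first by apply: huN => //; lia.
  rewrite -[k]opprK refl1 huN ?oppr0 //; lia.
have refl2 : (forall k, u (- k) = - u k) -> X <> Dn ->
    forall k, - n%:Z <= k <= n%:Z -> u k = 0.
  move=> refl2 XD k hk; have [k1|k1] := leP 1 k; first by apply: huN => //; lia.
  have [->|k0] := eqVneq k 0; first by apply: double0; rewrite -refl2 oppr0.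
  rewrite -[k]opprK refl2 huN ?oppr0 //; lia.
case: X rec refl hu c0 huN refl1 refl2 => rec refl hu c0 huN refl1 refl2.
- apply: (shift_rec_eq0 (k0 := 1 - n%:Z) p0 c0 _ rec) => [|k hk /=]; first by rewrite /=; lia.
  by apply: refl1 => //; move: hk => /=; lia.
- apply: (shift_rec_eq0 (k0 := - n%:Z) p0 c0 _ rec) => [|k hk /=]; first by rewrite /=; lia.
  by apply: refl2 => //; move: hk => /=; lia.
- apply: (shift_rec_eq0 (k0 := - n%:Z) p0 c0 _ rec) => [|k hk /=]; first by rewrite /=; lia.
  have [->|kn] := eqVneq k (n%:Z + 1); last by apply: refl2 => //; move: hk => /=; lia.
  apply: double0; rewrite -refl; have := rec (- (n%:Z + 1)); rewrite /=.
  have -> : - (n%:Z + 1) + (2 * n + 2)%N = n%:Z + 1 by lia.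
  have -> : p ^ (- (n%:Z + 1)) = (p ^+ (n + 1))^-1.
    by rewrite exprnN PoszD.
  by move/(mulfI c0) => ->.
- apply: (shift_rec_eq0 (k0 := 1 - n%:Z) p0 c0 _ rec) => [|k hk /=]; first by rewrite /=; lia.
  by apply: refl1 => //; move: hk => /=; lia.
- apply: (shift_rec_eq0 (k0 := 1 - n%:Z) p0 c0 _ rec) => [|k hk /=]; first by rewrite /=; lia.
  have [->|kn] := eqVneq k (n%:Z + 1); last by apply: refl1 => //; move: hk => /=; lia.
  apply: double0; rewrite -refl; have := rec (- n%:Z); rewrite /=.
  have -> : - n%:Z + (2 * n + 1)%N = n%:Z + 1 by lia.
  by rewrite -exprnN => /(mulfI c0) ->.
- have hD k : - (n%:Z - 1) <= k <= n%:Z - 1 -> u k = 0.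
    move=> hk; wlog k0 : k hk / 0 <= k.
      move=> H; have [k0|k0] := leP 0 k; first exact: H.
      by rewrite -[k]opprK refl; apply: H; lia.
    case: k k0 hk => // k _ hk; have kn : (k < n)%N by lia.
    exact: (hu (Ordinal kn)).
  have [n1|n1] := eqVneq n 1%N; last first.
    apply: (shift_rec_eq0 (k0 := 1 - n%:Z) p0 c0 _ rec) => [|k hk /=]; first by rewrite /=; lia.
    by apply: hD; move: hk => /=; lia.
  (* a constant function: p ^ k u_k = u_k *)
  move=> k; have [->|k0] := eqVneq k 0; first by apply: hD; lia.
  have := rec k; rewrite n1 /= expr0 invr1 mul1r addr0 => /eqP.
  rewrite -subr_eq0 -[X in _ - X]mul1r -mulrBl mulf_eq0 => /orP[|/eqP//].
  rewrite subr_eq0 => /eqP pk1; exfalso.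
  have : p ^+ `|k|%N = 1.
    have [e|e] : k = `|k|%N \/ k = - `|k|%N%:Z by lia.
      by rewrite exprnP -e.
    by apply: invr_inj; rewrite exprnN -e pk1 invr1.
  move/(congr1 (fun z : C => `|z|)); rewrite normrX normr1 => e.
  have k1 : `|k|%N != 0%N by rewrite absz_eq0.
  by have := exprn_ilt1 `|k|%N (normr_ge0 p) p_lt1; rewrite e ltxx k1.
Qed.

Lemma coef_reflect f (e : C) k : holomorphic f ->
  (forall x, x != 0 -> f x^-1 = e * f x) -> coef f (- k) = e * coef f k.
Proof.
move=> df finv; rewrite -coef_inv // -coefZ; last exact: holomorphic_circle.
exact: eq_coef.
Qed.

Lemma coef_reflect_half f k : holomorphic f ->
  (forall x, x != 0 -> f x^-1 = - x^-1 * f x) -> coef f (- k) = - coef f (k + 1).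
Proof.
move=> df finv; rewrite -coef_inv // -mulN1r.
have -> : k + 1 = k - -1 by rewrite opprK.
rewrite -coef_shift -coefZ.
  by apply: eq_coef => x x0; rewrite finv // mulNr mulN1r exprN1.
by apply: holomorphic_circle; apply: holomorphicM df; exact: holomorphic_exprz.
Qed.

Lemma R_separated n X : (0 < n)%N ->
  separated_space (R_theta_function p s n X) (fun (i : 'I_n) f => coef f (R_index X i)).
Proof.
move=> n0; split.
- split; first exact/holomorphic_puncturedP/holomorphic_cst.
  by move=> x _; rewrite !mulr0.
- move=> a f g [/holomorphic_puncturedP df fp] [/holomorphic_puncturedP dg gp].
  split; first exact/holomorphic_puncturedP/holomorphic_lin.
  move=> x x0; have [f1 f2] := fp x x0; have [g1 g2] := gp x x0.
  by rewrite f1 f2 g1 g2; split; ring.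
- by move=> i; rewrite coef0.
- move=> i a f g [/holomorphic_puncturedP df _] [/holomorphic_puncturedP dg _].
  exact: coef_lin.
- move=> f [/holomorphic_puncturedP df fp] f0; apply: (coef_eq0 df).
  apply: (R_coef_eq0 n0 _ _ f0) => [k|].
    apply: quasi_period_coef => // x x0.
    by rewrite (fp x x0).1 R_quasi_periodE.
  have finv x : x != 0 -> f x^-1 = R_inversion X x * f x.
    by move=> x0; rewrite -div1r (fp x x0).2.
  clear f0 fp; case: X finv => finv k.
  + by apply: coef_reflect_half => // x x0; rewrite finv //= div1r.
  + by rewrite (coef_reflect (e := -1)) ?mulN1r.
  + by rewrite (coef_reflect (e := -1)) ?mulN1r.
  + by apply: coef_reflect_half => // x x0; rewrite finv //= div1r.
  + by apply: coef_reflect_half => // x x0; rewrite finv //= div1r.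
  + by rewrite (coef_reflect (e := 1)) ?mul1r.
Qed.

End ThetaSpaces.

(** * The denominators as theta functions of each variable *)

Section Denominators.
Variable R : realType.
Local Notation C := R[i].
Implicit Types (x y a b t : C).

(** A transposition brings any slot to the first place, at the cost of a sign. *)
Lemma slotwise_ord0 m (V : (C -> C) -> Prop) (W : ('I_m.+1 -> C) -> C) :
  (forall c f, V f -> V (fun y => c * f y)) ->
  (forall f g, (forall y, y != 0 -> f y = g y) -> V f -> V g) ->
  alternating W ->
  (forall x : 'I_m.+1 -> C, (forall i, x i != 0) -> V (fun y => W (update x ord0 y))) -> slotwise V W.
Proof.
move=> Vscale Vext altW V0 x i x0; pose tau := tperm ord0 i.
have xs0 j : (x \o tau) j != 0 by exact: x0.
apply: Vext (Vscale ((-1) ^+ tau) _ (V0 _ xs0)) => y y0.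
rewrite -altW; last exact: update_neq0.
congr W; apply/funext => j; rewrite /update /= tpermK.
by rewrite -{1}(tpermR ord0 i) (inj_eq perm_inj).
Qed.

Lemma prod_pairs_update0 m (F : C -> C -> C) (x : 'I_m.+1 -> C) : exists c : C, forall y,
  \prod_(i < m.+1) \prod_(j < m.+1 | (i < j)%N) F (update x ord0 y i) (update x ord0 y j) =
  c * \prod_(j < m) F y (x (lift ord0 j)).
Proof.
exists (\prod_(i < m) \prod_(j < m.+1 | (lift ord0 i < j)%N) F (x (lift ord0 i)) (x j)) => y.
rewrite big_ord_recl mulrC; congr (_ * _).
  apply: eq_bigr => i _; apply: eq_bigr => j ij; rewrite /update /=.
  by case: eqP => // e; move: ij; rewrite e.
rewrite big_mkcond big_ord_recl /= mul1r; apply: eq_bigr => j _.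
by [].
Qed.

Lemma prod_update0 m (g : C -> C) (x : 'I_m.+1 -> C) y :
  \prod_(i < m.+1) g (update x ord0 y i) = g y * \prod_(i < m) g (x (lift ord0 i)).
Proof. by rewrite big_ord_recl /update eqxx. Qed.

Lemma alternating_pairs n (F : C -> C -> C) :
  (forall a b, a != 0 -> b != 0 -> F b a = - F a b) ->
  alternating (fun x : 'I_n -> C => \prod_(i < n) \prod_(j < n | (i < j)%N) F (x i) (x j)).
Proof.
move=> Fanti x s x0.
by apply: (prod_pairs_antisym (F := fun i j => F (x i) (x j))) => i j _; exact: Fanti.
Qed.

Lemma alternatingM n (S W : ('I_n -> C) -> C) :
  (forall (x : 'I_n -> C) (s : 'S_n), S (x \o s) = S x) -> alternating W ->
  alternating (fun x : 'I_n -> C => S x * W x).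
Proof. by move=> symS altW x s x0; rewrite symS altW // mulrCA. Qed.

Lemma prod_perm n (g : C -> C) (x : 'I_n -> C) (s : 'S_n) :
  \prod_(i < n) g ((x \o s) i) = \prod_(i < n) g (x i).
Proof. by rewrite [RHS](reindex_inj (@perm_inj _ s)). Qed.

Variables (p s : C).
Hypotheses (hp : 0 < `|p| < 1) (hs : s ^+ 2 = p).

Let p0 : p != 0 := p_neq0 hp.
Let p1 : `|p| < 1 := p_lt1 hp.
Let s0 : s != 0 := s_neq0 hp hs.

Let s1 : `|s| < 1.
Proof. by have := p1; rewrite -hs normrX expr_lt1. Qed.

Let pp0 : p ^+ 2 != 0. Proof. by rewrite expf_neq0. Qed.

Let pp1 : `|p ^+ 2| < 1. Proof. by rewrite normrX expr_lt1. Qed.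

Definition A_factor a b := b * thetaq p (a / b).
Definition D_factor a b := a^-1 * thetaq_pm p a b.

Definition R_factor (X : root_type) y : C := match X with
  | Bn => thetaq p y
  | Bnv => y^-1 * thetaq (p ^+ 2) (y ^+ 2)
  | Cn => y^-1 * thetaq p (y ^+ 2)
  | Cnv => thetaq s y
  | BCn => thetaq p y * thetaq (p ^+ 2) (p * y ^+ 2)
  | Dn => 1 end.

Lemma W_RE n X (x : 'I_n -> C) : W_R p s X x = \prod_(i < n) R_factor X (x i) * W_D p x.
Proof. by case: X => //=; rewrite big1 ?mul1r. Qed.

Lemma A_factor_anti a b : a != 0 -> b != 0 -> A_factor b a = - A_factor a b.
Proof.
move=> a0 b0; rewrite /A_factor -[b / a]invf_div thetaq_inv // ?mulf_neq0 ?invr_eq0 //.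
by field; rewrite a0 b0.
Qed.

Lemma A_factor_shift y a : y != 0 -> a != 0 ->
  A_factor (p * y) a = - (a / y) * A_factor y a.
Proof.
move=> y0 a0; rewrite /A_factor -mulrA thetaq_shift // ?mulf_neq0 ?invr_eq0 //.
by field; rewrite a0 y0.
Qed.

Lemma D_factor_anti a b : a != 0 -> b != 0 -> D_factor b a = - D_factor a b.
Proof.
move=> a0 b0; rewrite /D_factor /thetaq_pm -[b / a]invf_div thetaq_inv // ?mulf_neq0 ?invr_eq0 //.
by rewrite [b * a]mulrC; field; rewrite a0 b0.
Qed.

Lemma D_factor_shift y a : y != 0 -> a != 0 ->
  D_factor (p * y) a = (p * y ^+ 2)^-1 * D_factor y a.
Proof.
move=> y0 a0; rewrite /D_factor /thetaq_pm -[p * y * a]mulrA -[p * y / a]mulrA !thetaq_shift // ?mulf_neq0 ?invr_eq0 //.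
by field; rewrite a0 y0 p0.
Qed.

Lemma D_factor_inv y a : y != 0 -> a != 0 -> D_factor y^-1 a = D_factor y a.
Proof.
move=> y0 a0; rewrite /D_factor /thetaq_pm.
have -> : y^-1 * a = (y / a)^-1 by rewrite invf_div mulrC.
have -> : y^-1 / a = (y * a)^-1 by rewrite invfM.
rewrite !thetaq_inv // ?mulf_neq0 ?invr_eq0 //.
by field; rewrite a0 y0.
Qed.

Definition R_factor_period (X : root_type) y : C := match X with
  | Bn => - y^-1 | Bnv => - (p * y ^+ 2)^-1 | Cn => (p ^+ 2 * y ^+ 4)^-1
  | Cnv => (s * y ^+ 2)^-1 | BCn => (p * y ^+ 3)^-1 | Dn => 1 end.

Lemma R_factor_shift X y : y != 0 -> R_factor X (p * y) = R_factor_period X y * R_factor X y.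
Proof.
move=> y0; have yy0 : y ^+ 2 != 0 by rewrite expf_neq0.
case: X => /=; rewrite ?mulr1 //.
- by rewrite thetaq_shift.
- by rewrite exprMn thetaq_shift //; field; rewrite y0 p0.
- have -> : (p * y) ^+ 2 = p * (p * y ^+ 2) by ring.
  rewrite !thetaq_shift // ?mulf_neq0 //.
  by field; rewrite y0 p0.
- have -> : p * y = s * (s * y) by rewrite -hs expr2 mulrA.
  rewrite !thetaq_shift // ?mulf_neq0 //.
  by field; rewrite y0 s0.
- have -> : p * (p * y) ^+ 2 = p ^+ 2 * (p * y ^+ 2) by ring.
  rewrite !thetaq_shift // ?mulf_neq0 //.
  by field; rewrite y0 p0.
Qed.

Lemma R_factor_inv X y : y != 0 -> R_factor X y^-1 = R_inversion X y * R_factor X y.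
Proof.
move=> y0; have yy0 : y ^+ 2 != 0 by rewrite expf_neq0.
case: X => /=; rewrite ?mulr1 ?div1r //.
- by rewrite thetaq_inv.
- by rewrite exprVn thetaq_inv //; field; rewrite y0.
- by rewrite exprVn thetaq_inv //; field; rewrite y0.
- by rewrite thetaq_inv.
- rewrite thetaq_inv // -mulrA; congr (_ * (_ * _)).
  have -> : p * y^-1 ^+ 2 = p ^+ 2 / (p * y ^+ 2) by field; rewrite y0 p0.
  by rewrite thetaq_sym // mulf_neq0.
Qed.

Lemma R_quasi_periodS m X y : y != 0 ->
  R_quasi_period p s m.+1 X y = R_factor_period X y * ((p * y ^+ 2)^-1) ^+ m.
Proof.
move=> y0; rewrite exprVn exprMn.
have e1 : (m.+1 - 1 = m)%N by rewrite subn1.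
have e3 : (2 * m.+1 = (2 * m).+2)%N by rewrite mulnS.
have e2 : (2 * m.+1 - 1 = (2 * m).+1)%N by rewrite e3 subn1.
have e4 : (2 * m.+1 - 2 = 2 * m)%N by rewrite e3 subn2.
have pm0 : p ^+ m != 0 by rewrite expf_neq0.
have ym0 : (y ^+ 2) ^+ m != 0 by rewrite !expf_neq0.
have yE k : y ^+ (k + 2 * m)%N = y ^+ k * (y ^+ 2) ^+ m by rewrite exprD exprM.
have pE k : p ^+ (k + m)%N = p ^+ k * p ^+ m by rewrite exprD.
have sE : s ^+ (2 * m).+1 = s * p ^+ m by rewrite exprS exprM hs.
case: X => /=.
- by rewrite e1 e2 (yE 1%N) expr1; field; rewrite y0 pm0 ym0.
- by rewrite e3 (yE 2%N) (pE 1%N) expr1; field; rewrite y0 p0 pm0 ym0.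
- by rewrite e3 addn1 addn2 (yE 4%N) (pE 2%N); field; rewrite y0 p0 pm0 ym0.
- by rewrite e2 e3 (yE 2%N) sE; field; rewrite y0 s0 pm0 ym0.
- by rewrite e3 addn1 (yE 3%N) (pE 1%N) expr1; field; rewrite y0 p0 pm0 ym0.
- by rewrite e1 e4 exprM.
Qed.

Lemma holomorphic_scale a : holomorphic (fun y : C => y * a).
Proof. by apply: holomorphicM; [exact: holomorphic_id|exact: holomorphic_cst]. Qed.

Lemma holomorphic_invr : holomorphic (fun y : C => y^-1).
Proof. by move=> z z0; exact: cderivableV. Qed.

Lemma holomorphic_sqr : holomorphic (fun y : C => y ^+ 2).
Proof. by move=> z _; apply: cderivableX; exact: cderivable_id. Qed.

Lemma holomorphic_theta_scale (q a : C) : q != 0 -> `|q| < 1 -> a != 0 ->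
  holomorphic (fun y => thetaq q (y * a)).
Proof.
move=> q0 q1 a0; apply: (holomorphic_comp (holomorphic_thetaq q0 q1) (@holomorphic_scale a)).
by move=> z z0; rewrite mulf_neq0.
Qed.

Lemma holomorphic_theta_sqr (q a : C) : q != 0 -> `|q| < 1 -> a != 0 ->
  holomorphic (fun y => thetaq q (a * y ^+ 2)).
Proof.
move=> q0 q1 a0; apply: (holomorphic_comp (holomorphic_thetaq q0 q1)).
  by apply: holomorphicM; [exact: holomorphic_cst|exact: holomorphic_sqr].
by move=> z z0; rewrite mulf_neq0 // expf_neq0.
Qed.

Lemma holomorphic_prod (I : Type) (r : seq I) (F : I -> C -> C) :
  (forall i, holomorphic (F i)) -> holomorphic (fun y => \prod_(i <- r) F i y).
Proof. by move=> dF z z0; apply: cderivable_prod => i _; exact: dF. Qed.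

Lemma holomorphic_D_factor a : a != 0 -> holomorphic (D_factor^~ a).
Proof.
move=> a0; apply: holomorphicM; first exact: holomorphic_invr.
by apply: holomorphicM; apply: holomorphic_theta_scale; rewrite ?invr_eq0.
Qed.

Lemma holomorphic_R_factor X : holomorphic (R_factor X).
Proof.
have sq (q : C) : q != 0 -> `|q| < 1 -> holomorphic (fun y => thetaq q (y ^+ 2)).
  move=> q0 q1; have := holomorphic_theta_sqr q0 q1 (oner_neq0 _).
  by under eq_fun do rewrite mul1r.
case: X => /=.
- exact: holomorphic_thetaq.
- by apply: holomorphicM; [exact: holomorphic_invr|exact: sq].
- by apply: holomorphicM; [exact: holomorphic_invr|exact: sq].
- exact: holomorphic_thetaq.
- by apply: holomorphicM; [exact: holomorphic_thetaq|exact: holomorphic_theta_sqr].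
- exact: holomorphic_cst.
Qed.

(** Each variable of a denominator contributes its own factor and n - 1 pair factors;
the quasi-periods of these multiply up to the prescribed one. *)
Lemma slotwise_W_R n X : slotwise (R_theta_function p s n X) (W_R (n := n) p s X).
Proof.
case: n => [|m]; first by move=> x [].
have altD : alternating (W_D p (n := m.+1)).
  exact: (alternating_pairs (F := D_factor) D_factor_anti).
have WE : W_R p s X = (fun x : 'I_m.+1 -> C => \prod_i R_factor X (x i) * W_D p x).
  by apply/funext => x; exact: W_RE.
apply: slotwise_ord0.
- move=> c f [/holomorphic_puncturedP df fp]; split.
    by apply/holomorphic_puncturedP/holomorphicM => //; exact: holomorphic_cst.
  by move=> x x0; have [-> ->] := fp x x0; split; ring.
- move=> f g fg [/holomorphic_puncturedP df fp]; split.
    by apply/holomorphic_puncturedP; exact: eq_holomorphic df.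
  move=> x x0; have [f1 f2] := fp x x0; rewrite -!fg // ?f1 ?f2 //.
    by rewrite mulf_neq0 ?invr_eq0 ?oner_neq0.
  by rewrite mulf_neq0.
- by rewrite WE; apply: alternatingM altD => x sg; exact: prod_perm.
move=> x x0; have [c hc] := prod_pairs_update0 D_factor x.
pose c' := (\prod_(i < m) R_factor X (x (lift ord0 i))) * c.
pose a (j : 'I_m) := x (lift ord0 j).
have a0 j : a j != 0 by exact: x0.
pose T y := R_factor X y * \prod_(j < m) D_factor y (a j).
have -> : (fun y => W_R p s X (update x ord0 y)) = (fun y => c' * T y).
  apply/funext => y; rewrite W_RE (prod_update0 (R_factor X)).
  by rewrite [W_D _ _](hc y) /c' /T; ring.
split.
  apply/holomorphic_puncturedP; apply: holomorphicM; first exact: holomorphic_cst.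
  apply: holomorphicM; first exact: holomorphic_R_factor.
  by apply: holomorphic_prod => j; exact: holomorphic_D_factor.
move=> y y0; rewrite div1r /T; split.
- rewrite R_factor_shift // (eq_bigr (fun j => (p * y ^+ 2)^-1 * D_factor y (a j))); last first.
    by move=> j _; exact: D_factor_shift.
  rewrite big_split /= prodr_const card_ord R_quasi_periodS //.
  by ring.
- rewrite R_factor_inv // (eq_bigr (fun j => D_factor y (a j))); last first.
    by move=> j _; exact: D_factor_inv.
  by ring.
Qed.

Lemma alternating_W_R n X : alternating (W_R (n := n) p s X).
Proof.
have -> : W_R p s X = (fun x : 'I_n -> C => \prod_i R_factor X (x i) * W_D p x).
  by apply/funext => x; exact: W_RE.
apply: alternatingM => [x sg|]; first exact: prod_perm.
exact: (alternating_pairs (F := D_factor) D_factor_anti).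
Qed.

Definition A_denominator n t (x : 'I_n -> C) := thetaq p (t * \prod_(i < n) x i) * W_A p x.

Lemma alternating_A n t : alternating (A_denominator (n := n) t).
Proof.
apply: alternatingM => [x sg|]; first by rewrite (prod_perm id).
exact: (alternating_pairs (F := A_factor) A_factor_anti).
Qed.

(** The pair factors contribute (-x_j / y) each and the theta factor -1 / (t y x_2 ... x_n):
the other variables cancel from the product. *)
Lemma slotwise_A n t : t != 0 -> slotwise (A_theta_function p n t) (A_denominator (n := n) t).
Proof.
move=> t0; case: n => [|m]; first by move=> x [].
apply: slotwise_ord0.
- move=> c f [/holomorphic_puncturedP df fp]; split.
    by apply/holomorphic_puncturedP/holomorphicM => //; exact: holomorphic_cst.
  by move=> x x0; rewrite fp //; ring.
- move=> f g fg [/holomorphic_puncturedP df fp]; split.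
    by apply/holomorphic_puncturedP; exact: eq_holomorphic df.
  by move=> x x0; rewrite -!fg ?fp // mulf_neq0.
- exact: alternating_A.
move=> x x0; have [c hc] := prod_pairs_update0 A_factor x.
pose a (j : 'I_m) := x (lift ord0 j).
have a0 j : a j != 0 by exact: x0.
pose b := t * \prod_j a j.
have pa0 : \prod_j a j != 0 by apply/prodf_neq0 => j _.
have b0 : b != 0 by rewrite mulf_neq0.
pose T y := thetaq p (y * b) * \prod_(j < m) A_factor y (a j).
have -> : (fun y => A_denominator t (update x ord0 y)) = (fun y => c * T y).
  apply/funext => y; rewrite /A_denominator (prod_update0 id) [W_A _ _](hc y) /T /b.
  by rewrite mulrCA; congr (_ * (thetaq p _ * _)); exact: mulrCA.
split.
  apply/holomorphic_puncturedP; apply: holomorphicM; first exact: holomorphic_cst.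
  apply: holomorphicM; first exact: holomorphic_theta_scale.
  apply: holomorphic_prod => j; apply: holomorphicM; first exact: holomorphic_cst.
  by apply: holomorphic_theta_scale => //; rewrite invr_eq0.
move=> y y0; rewrite /T -mulrA thetaq_shift ?mulf_neq0 //.
rewrite (eq_bigr (fun j => (- y^-1) * a j * A_factor y (a j))); last first.
  by move=> j _; rewrite A_factor_shift //; congr (_ * _); ring.
rewrite !big_split /= prodr_const card_ord [(- y^-1) ^+ m]exprNn exprVn !exprS /b.
have ym0 : y ^+ m != 0 by rewrite expf_neq0.
by field; rewrite t0 y0 pa0 ym0.
Qed.

End Denominators.

(** * Nonvanishing of the denominators *)

Section Nonvanishing.
Variable R : realType.
Local Notation C := R[i].

Lemma normc_expR (b : R) : `|(expR b)%:C| = (expR b)%:C :> C.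
Proof. by rewrite ger0_norm // lecR expR_ge0. Qed.

Lemma norm_expR_ln (z : C) : z != 0 -> exists l : R, `|z| = (expR l)%:C.
Proof.
move=> z0; exists (ln (complex.Re `|z|)).
have e : `|z| = (complex.Re `|z|)%:C by rewrite RRe_real // normr_real.
rewrite lnK -?e // posrE -ltcR -e; by rewrite normr_gt0.
Qed.

Lemma thetaq_neq0_expR (q x : C) (l b : R) : `|q| = (expR l)%:C -> `|x| = (expR b)%:C ->
  l < b < 0 -> thetaq q x != 0.
Proof.
move=> ql xb /andP[lb b0].
have h (u v : R) : u < v -> (expR u)%:C < (expR v)%:C :> C by move=> uv; rewrite ltcR ltr_expR.
have e1 : 1 = (expR 0)%:C :> C by rewrite expR0.
apply: thetaq_neq0; rewrite ?ql ?xb.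
- by rewrite e1; apply: h; exact: lt_trans b0.
- exact: h.
- by rewrite e1; exact: h.
Qed.

Variables (p s : C).
Hypotheses (hp : 0 < `|p| < 1) (hs : s ^+ 2 = p).

(* the period of the logarithmic scale: |p| = exp (- 2 L) and |s| = exp (- L) *)
Let norm_p : exists L : R, [/\ 0 < L, `|s| = (expR (- L))%:C & `|p| = (expR (- (2 * L)))%:C].
Proof.
have [l hl] := norm_expR_ln (s_neq0 hp hs).
have pE : `|p| = (expR (2 * l))%:C.
  by rewrite -hs normrX hl -rmorphXn /= -expRM_natl.
exists (- l); rewrite mulrN !opprK; split=> //.
have e1 : 1 = (expR 0)%:C :> C by rewrite expR0.
rewrite oppr_gt0; have := p_lt1 hp; rewrite pE e1 ltcR ltr_expR.
by rewrite pmulr_rlt0.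
Qed.

(** Points of increasing moduli in the open annulus |s| < |x| < 1: all the arguments
of the theta functions then have a modulus strictly between that of the nome and 1. *)
Lemma W_R_neq0 n X : exists z : 'I_n -> C, (forall i, z i != 0) /\ W_R p s X z != 0.
Proof.
have [L [L0 sL pL]] := norm_p.
pose b (i : 'I_n) : R := - (L * ((n - i)%N%:R / n.+1%:R)).
have bL i : - L < b i < 0.
  have n0 : 0 < (n - i)%N%:R / n.+1%:R :> R.
    by rewrite divr_gt0 ?ltr0n // subn_gt0.
  rewrite ltrN2 oppr_lt0 mulr_gt0 // andbT -[ltRHS]mulr1 ltr_pM2l //.
  by rewrite ltr_pdivrMr ?ltr0n // mul1r ltr_nat ltnS leq_subr.
have bij (i j : 'I_n) : (i < j)%N -> b i < b j.
  move=> ij; rewrite ltrN2 ltr_pM2l // ltr_pM2r ?invr_gt0 ?ltr0n // ltr_nat.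
  by have := ltn_ord j; lia.
pose z i : C := (expR (b i))%:C.
have z0 i : z i != 0 by rewrite -normr_gt0 normc_expR ltcR expR_gt0.
have zb i : `|z i| = (expR (b i))%:C by exact: normc_expR.
have zz i : `|z i ^+ 2| = (expR (2 * b i))%:C.
  by rewrite normrX zb -rmorphXn /= -expRM_natl.
have pp : `|p ^+ 2| = (expR (- (4 * L)))%:C.
  by rewrite normrX pL -rmorphXn /= -expRM_natl; congr (expR _)%:C; ring.
exists z; split=> //; rewrite W_RE; apply: mulf_neq0.
  apply/prodf_neq0 => i _; have /andP[b1 b2] := bL i.
  have zV : (z i)^-1 != 0 by rewrite invr_eq0.
  case: X => /=; try exact: oner_neq0.
  - by apply: (thetaq_neq0_expR pL (zb i)); lra.
  - by apply: (mulf_neq0 zV); apply: (thetaq_neq0_expR pp (zz i)); lra.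
  - by apply: (mulf_neq0 zV); apply: (thetaq_neq0_expR pL (zz i)); lra.
  - by apply: (thetaq_neq0_expR sL (zb i)); lra.
  - apply: mulf_neq0; first by apply: (thetaq_neq0_expR pL (zb i)); lra.
    apply: (thetaq_neq0_expR (b := - (2 * L) + 2 * b i) pp); last by lra.
    by rewrite normrM pL zz -rmorphM /= -expRD.
apply/prodf_neq0 => i _; apply/prodf_neq0 => j ij.
have /andP[b1 b2] := bL i; have /andP[b3 b4] := bL j; have b5 := bij _ _ ij.
apply: mulf_neq0; first by rewrite invr_eq0.
apply: mulf_neq0.
- apply: (thetaq_neq0_expR (b := b i + b j) pL); last by lra.
  by rewrite normrM !zb -rmorphM /= -expRD.
- apply: (thetaq_neq0_expR (b := b i - b j) pL); last by lra.
  by rewrite normrM normfV !zb -fmorphV -rmorphM /= -expRB.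
Qed.

(** The ratios only need moduli strictly between |p| and 1, which leaves a common factor
exp c free; it is chosen to bring t x_1 ... x_n to the modulus |s|. *)
Lemma A_denominator_neq0 n (t : C) : (0 < n)%N -> t != 0 ->
  exists z : 'I_n -> C, (forall i, z i != 0) /\ A_denominator p t z != 0.
Proof.
move=> n0 t0; have [L [L0 sL pL]] := norm_p; have [tau ht] := norm_expR_ln t0.
have nn0 : 0 < n%:R :> R by rewrite ltr0n.
pose d (i : 'I_n) : R := L * (i%:R / n%:R).
pose c : R := (- L - tau - \sum_i d i) / n%:R.
pose b i := c + d i.
have dij (i j : 'I_n) : (i < j)%N -> - L < d i - d j < 0.
  move=> ij; have i0 : 0 <= d i by rewrite mulr_ge0 ?(ltW L0) // divr_ge0.
  have j1 : d j < L.
    by rewrite -[ltRHS]mulr1 ltr_pM2l // ltr_pdivrMr // mul1r ltr_nat.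
  have dd : d i < d j by rewrite ltr_pM2l // ltr_pM2r ?invr_gt0 // ltr_nat.
  by lra.
pose z i : C := (expR (b i))%:C.
have z0 i : z i != 0 by rewrite -normr_gt0 normc_expR ltcR expR_gt0.
have zb i : `|z i| = (expR (b i))%:C by exact: normc_expR.
exists z; split=> //; apply: mulf_neq0.
  apply: (thetaq_neq0_expR (b := - L) pL); last by lra.
  rewrite normrM ht normr_prod (eq_bigr (fun i => (expR (b i))%:C)) //.
  rewrite -rmorph_prod -rmorphM /= -expR_sum -expRD; congr (expR _)%:C.
  rewrite big_split /= sumr_const card_ord -[c *+ n]mulr_natr /c divfK ?gt_eqF //.
  by ring.
apply/prodf_neq0 => i _; apply/prodf_neq0 => j ij.
apply: mulf_neq0; first exact: z0.
apply: (thetaq_neq0_expR (b := d i - d j) pL).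
  rewrite normrM normfV !zb -fmorphV -rmorphM /= -expRB; congr (expR _)%:C.
  by rewrite /b; ring.
by have := dij _ _ ij; lra.
Qed.

End Nonvanishing.

(** * The determinant formulas *)

Theorem proposition3p4 (R : realType) (p s : R[i])
    (hp : 0 < `|p| < 1) (hs : s ^+ 2 = p) (n : nat) (hn : (1 <= n)%N) :
  (forall (t : R[i]) (f : 'I_n -> R[i] -> R[i]),
      t != 0 -> (forall j : 'I_n, A_theta_function p n t (f j)) ->
      exists C : R[i], forall x : 'I_n -> R[i], (forall i : 'I_n, x i != 0) ->
        \det (\matrix_(i < n, j < n) f j (x i)) =
          C * thetaq p (t * \prod_(i < n) x i) * W_A p x)
  /\
  (forall (X : root_type) (f : 'I_n -> R[i] -> R[i]),
      (forall j : 'I_n, R_theta_function p s n X (f j)) ->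
      exists C : R[i], forall x : 'I_n -> R[i], (forall i : 'I_n, x i != 0) ->
        \det (\matrix_(i < n, j < n) f j (x i)) = C * W_R p s X x).
Proof.
split=> [t f t0 hf|X f hf].
- have [z [z0 Wz]] := A_denominator_neq0 hp hs hn t0.
  have [C hC] := det_proportional (A_separated hp t0 hn) (slotwise_A hp t0)
    (alternating_A hp t) z0 Wz hf.
  by exists C => x x0; rewrite hC // mulrA.
- have [z [z0 Wz]] := W_R_neq0 hp hs n X.
  have altW := @alternating_W_R _ _ s hp n X.
  exact: (det_proportional (R_separated hp hs X hn) (slotwise_W_R hp hs X) altW z0 Wz hf).
Qed.
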